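(* Let $R$ be an associative ring with identity. The following assertions are equivalent: (1) $R$ is an $IF$-ring. (2) Any left $R$-module embeds in a flat module. (3) Any pure-projective left $R$-module embeds in a flat module. (4) Any finitely presented left $R$-module embeds in a flat module. (5) For any flat right $R$-module $F$, $F^+$ is flat. (6) For any injective left $R$-module $E$ and any submodule $N$ of $E$, if $N$ is injective then $E/N$ is flat. (7) For any injective left $R$-module $E$ and any submodule $N$ of $E$, if $N$ is $FP$-injective then $E/N$ is flat. (8) There exists an f-rugged left $R$-module that embeds in a flat module.
   Context: Modules are unital left $R$-modules unless stated otherwise. $R$ is an $IF$-ring if every injective left $R$-module is flat. $F^+=\mathrm{Hom}_{\mathbb{Z}}(F,\mathbb{Q}/\mathbb{Z})$ is the character module. A module $N$ is $FP$-injective if $\mathrm{Ext}^1(F,N)=0$ for every finitely presented module $F$. A flat precover of a module $N$ is a morphism $g:F\to N$ with $F$ flat such that $\mathrm{Hom}(F',F)\to\mathrm{Hom}(F',N)$ is surjective for every flat module $F'$. The flat-precover completing domain $\mathfrak{F}^{-1}(M)$ is the class of all modules $N$ such that for every morphism $f:M\to N$ and every flat precover $g:F\to N$ there is a morphism $h:M\to F$ with $gh=f$. A module $M$ is f-rugged if $\mathfrak{F}^{-1}(M)$ is as small as possible, i.e. consists exactly of the flat modules. *)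

(* Defs.v *)
From HB Require Import structures.
From mathcomp Require Import all_boot all_order all_algebra.
From mathcomp Require Import generic_quotient ring_quotient boolp functions.
Set Implicit Arguments.
Unset Strict Implicit.
Unset Printing Implicit Defensive.
Import GRing.Theory.
Local Open Scope ring_scope.
Local Open Scope quotient_scope.

(* Rings are [pzRingType]s: the zero ring is allowed.  A left R-module is an
   [lmodType R]; a right R-module is an [lmodType R^c] over the converse ring,
   the right action of r on x being [(r : R^c) *: x]. *)

Definition surjective_map (A B : Type) (f : A -> B) : Prop :=
  forall y, exists x, f x = y.

Section Tensor.
Variables (R : pzRingType) (A : lmodType R^c) (M : lmodType R).
Implicit Types (a : A) (m : M) (r : R) (s t u : seq (A * M)).

(* [:: (a1, m1); ...; (an, mn)] stands for the formal sum of the ai (x) mi.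
   No formal negatives are needed, since - (a (x) m) = (- a) (x) m. *)
Inductive tensor_eq : seq (A * M) -> seq (A * M) -> Prop :=
| Teq_refl s : tensor_eq s s
| Teq_sym s t : tensor_eq s t -> tensor_eq t s
| Teq_trans s t u : tensor_eq s t -> tensor_eq t u -> tensor_eq s u
| Teq_cat s s' t t' :
    tensor_eq s s' -> tensor_eq t t' -> tensor_eq (s ++ t) (s' ++ t')
| Teq_catC s t : tensor_eq (s ++ t) (t ++ s)
| Teq_0l m : tensor_eq [:: (0, m)] [::]
| Teq_Dl a a' m : tensor_eq [:: (a + a', m)] [:: (a, m); (a', m)]
| Teq_Dr a m m' : tensor_eq [:: (a, m + m')] [:: (a, m); (a, m')]
| Teq_bal r a m : tensor_eq [:: ((r : R^c) *: a, m)] [:: (a, r *: m)].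

Definition tensor_rel : rel (seq (A * M)) := fun s t => `[< tensor_eq s t >].

Lemma tensor_rel_equiv : equiv_class_of tensor_rel.
Proof.
split=> [s|s t|t s u]; first by apply/asboolP; exact: Teq_refl.
  by apply/asboolP/asboolP; exact: Teq_sym.
by move=> /asboolP st /asboolP tu; apply/asboolP; exact: Teq_trans st tu.
Qed.

Canonical tensor_rel_equivRel := EquivRelPack tensor_rel_equiv.
Canonical tensor_rel_encModRel := defaultEncModRel tensor_rel.

Definition tensor := {eq_quot tensor_rel}.

HB.instance Definition _ : EqQuotient _ tensor_rel tensor :=
  EqQuotient.on tensor.
HB.instance Definition _ := Choice.on tensor.

Lemma tensorP s t : reflect (tensor_eq s t) (s == t %[mod tensor]).
Proof. by rewrite piE; exact: asboolP. Qed.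

Lemma tensor_eqP s t : \pi_tensor s = \pi_tensor t <-> tensor_eq s t.
Proof. by split=> [/eqP/tensorP|/tensorP/eqP]. Qed.

Definition tensor_oppT s : seq (A * M) := [seq (- p.1, p.2) | p <- s].

Lemma tensor_addN s : tensor_eq (tensor_oppT s ++ s) [::].
Proof.
elim: s => [|[a m] s IHs]; first exact: Teq_refl.
apply: (@Teq_trans _ ([:: (- a, m); (a, m)] ++ (tensor_oppT s ++ s))).
  have -> : tensor_oppT ((a, m) :: s) ++ (a, m) :: s
      = [:: (- a, m)] ++ ((tensor_oppT s ++ [:: (a, m)]) ++ s).
    by rewrite -catA.
  apply: (@Teq_cat [:: (- a, m)] [:: (- a, m)] _
    (([:: (a, m)] ++ tensor_oppT s) ++ s)).
    exact: Teq_refl.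
  by apply: Teq_cat; [exact: Teq_catC | exact: Teq_refl].
rewrite -[X in tensor_eq _ X]cat0s; apply: Teq_cat IHs.
apply: Teq_trans (Teq_0l m); apply: Teq_sym; rewrite -[X in (X, _)](addNr a).
exact: Teq_Dl.
Qed.

Lemma tensor_oppT_eq s t :
  tensor_eq s t -> tensor_eq (tensor_oppT s) (tensor_oppT t).
Proof.
move=> st; rewrite -[tensor_oppT s]cats0.
apply: Teq_trans (_ : tensor_eq (tensor_oppT s ++ (s ++ tensor_oppT t)) _).
  apply: Teq_cat; first exact: Teq_refl.
  apply: Teq_trans (_ : tensor_eq (tensor_oppT t ++ t) _).
    by apply: Teq_sym; exact: tensor_addN.
  apply: Teq_trans (Teq_catC _ _) _.
  by apply: Teq_cat; [exact: Teq_sym | exact: Teq_refl].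
rewrite catA -[X in tensor_eq _ X]cat0s.
by apply: Teq_cat; [exact: tensor_addN | exact: Teq_refl].
Qed.

Definition tensor_zero : tensor := \pi_tensor [::].
Definition tensor_add (x y : tensor) : tensor := \pi_tensor (repr x ++ repr y).
Definition tensor_opp (x : tensor) : tensor :=
  \pi_tensor (tensor_oppT (repr x)).

Lemma tensor_repr s : tensor_eq (repr (\pi_tensor s)) s.
Proof. by apply/tensor_eqP; rewrite reprK. Qed.

Lemma tensor_addE s t :
  tensor_add (\pi_tensor s) (\pi_tensor t) = \pi_tensor (s ++ t).
Proof. by apply/tensor_eqP/Teq_cat; exact: tensor_repr. Qed.

Lemma tensor_oppE s : tensor_opp (\pi_tensor s) = \pi_tensor (tensor_oppT s).
Proof. by apply/tensor_eqP/tensor_oppT_eq/tensor_repr. Qed.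

Lemma tensor_addA : associative tensor_add.
Proof.
elim/quotW=> s; elim/quotW=> t; elim/quotW=> u.
by rewrite (tensor_addE t u) (tensor_addE s t) !tensor_addE catA.
Qed.

Lemma tensor_addC : commutative tensor_add.
Proof. by move=> x y; apply/tensor_eqP/Teq_catC. Qed.

Lemma tensor_add0 : left_id tensor_zero tensor_add.
Proof. by move=> x; rewrite -[x]reprK tensor_addE. Qed.

Lemma tensor_addNx : left_inverse tensor_zero tensor_opp tensor_add.
Proof.
move=> x; rewrite -[x]reprK tensor_oppE tensor_addE.
by apply/tensor_eqP/tensor_addN.
Qed.

HB.instance Definition _ := GRing.isZmodule.Build tensor
  tensor_addA tensor_addC tensor_add0 tensor_addNx.

Definition pure_tensor a m : tensor := \pi_tensor [:: (a, m)].

Lemma tensor_sumE s :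
  \pi_tensor s = \sum_(p <- s) pure_tensor p.1 p.2.
Proof.
elim: s => [|[a m] s IHs]; first by rewrite big_nil.
by rewrite big_cons -IHs /= -[RHS]/(tensor_add _ _) tensor_addE.
Qed.

Definition balanced (G : zmodType) (b : A -> M -> G) : Prop :=
  [/\ forall a a' m, b (a + a') m = b a m + b a' m,
      forall a m m', b a (m + m') = b a m + b a m'
    & forall (r : R) a m, b ((r : R^c) *: a) m = b a (r *: m)].

Lemma pure_tensor_balanced : balanced pure_tensor.
Proof.
have E (s : seq (A * M)) (a : A) (m : M) :
    pure_tensor a m + \pi_tensor s = \pi_tensor ((a, m) :: s).
  by rewrite -[LHS]/(tensor_add _ _) tensor_addE.
split=> *; rewrite ?E; apply/tensor_eqP.
- exact: Teq_Dl.
- exact: Teq_Dr.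
exact: Teq_bal.
Qed.

Lemma tensor_universal (G : zmodType) (b : A -> M -> G) : balanced b ->
  exists2 f : {additive tensor -> G},
    forall a m, f (pure_tensor a m) = b a m
  & forall g : {additive tensor -> G},
      (forall a m, g (pure_tensor a m) = b a m) -> g =1 f.
Proof.
move=> [bDl bDr bZ].
pose ev (s : seq (A * M)) := \sum_(p <- s) b p.1 p.2.
have evP s t : tensor_eq s t -> ev s = ev t.
  rewrite /ev; elim=> {s t} [//|//|s t u _ -> _ -> //|s s' t t' _ IHs _ IHt
    |s t|m|a a' m|a m m'|r a m]; rewrite ?big_cat ?big_cons ?big_nil /= ?addr0.
  - by rewrite IHs IHt.
  - exact: addrC.
  - by apply: (addrI (b 0 m)); rewrite -bDl !addr0.
  - exact: bDl.
  - exact: bDr.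
  - exact: bZ.
pose f (x : tensor) := ev (repr x).
have fE s : f (\pi_tensor s) = ev s by apply/evP/tensor_repr.
have f_add : nmod_morphism f.
  split; first by rewrite -[0]/(\pi_tensor [::]) fE /ev big_nil.
  move=> x y; rewrite -[x]reprK -[y]reprK -[_ + _]/(tensor_add _ _).
  by rewrite tensor_addE !fE /ev big_cat.
pose F : {additive tensor -> G} :=
  HB.pack f (GRing.isNmodMorphism.Build _ _ f f_add).
exists F => [a m|g gE x]; first by rewrite /= fE /ev big_seq1.
rewrite -[x]reprK tensor_sumE !raddf_sum; apply: eq_bigr => p _.
by rewrite gE /= fE /ev big_seq1.
Qed.

End Tensor.

Section TensorMap.
Variables (R : pzRingType) (A B : lmodType R^c) (M N : lmodType R).
Variables (f : {linear A -> B}) (g : {linear M -> N}).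

Definition tensor_map (x : tensor A M) : tensor B N :=
  \pi_(tensor B N) [seq (f p.1, g p.2) | p <- repr x].

Lemma tensor_map_eq (s t : seq (A * M)) : tensor_eq s t ->
  tensor_eq [seq (f p.1, g p.2) | p <- s] [seq (f p.1, g p.2) | p <- t].
Proof.
elim=> {s t}
  [s|s t _|s t u _ + _|s s' t t' _ IHs _ IHt|s t|m|a a' m|a m m'|r a m];
  rewrite ?map_cat /= ?linear0 ?linearD ?linearZ.
- exact: Teq_refl.
- exact: Teq_sym.
- exact: Teq_trans.
- exact: Teq_cat.
- exact: Teq_catC.
- exact: Teq_0l.
- exact: Teq_Dl.
- exact: Teq_Dr.
- exact: Teq_bal.
Qed.

Lemma tensor_mapE (s : seq (A * M)) :
  tensor_map (\pi s) = \pi_(tensor B N) [seq (f p.1, g p.2) | p <- s].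
Proof. by apply/tensor_eqP/tensor_map_eq/tensor_repr. Qed.

Lemma tensor_map_pure a m :
  tensor_map (pure_tensor a m) = pure_tensor (f a) (g m).
Proof. by rewrite tensor_mapE. Qed.

Lemma tensor_map_is_additive : nmod_morphism tensor_map.
Proof.
split; first by rewrite -[0]/(\pi_(tensor A M) [::]) tensor_mapE.
move=> x y; rewrite -[x]reprK -[y]reprK -[_ + _]/(tensor_add _ _).
by rewrite tensor_addE !tensor_mapE map_cat -tensor_addE.
Qed.

HB.instance Definition _ := GRing.isNmodMorphism.Build
  (tensor A M) (tensor B N) tensor_map tensor_map_is_additive.

End TensorMap.

Section Submodule.
Variables (R : pzRingType) (E : lmodType R) (N : submodClosed E).

Record submod := Submod {submod_val : E; _ : submod_val \in N}.

HB.instance Definition _ := [isSub for submod_val].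
HB.instance Definition _ := [Choice of submod by <:].
HB.instance Definition _ := [SubChoice_isSubLmodule of submod by <:].

(* The library quotient [{quot _}] is by a [zmodClosed] predicate, an instance
   that [submodClosed] does not carry. *)
Definition submod_pred : {pred E} := fun x => x \in N.

Lemma submod_pred_closed : zmod_closed submod_pred.
Proof.
split=> [|x y Nx Ny]; rewrite /submod_pred unfold_in; first exact: rpred0.
by apply: rpredD => //; rewrite -scaleN1r; exact: rpredZ.
Qed.

HB.instance Definition _ := GRing.isZmodClosed.Build E submod_pred
  submod_pred_closed.

Definition quotmod := Quotient.quot submod_pred.

HB.instance Definition _ := EqQuotient.on quotmod.
HB.instance Definition _ := GRing.Zmodule.on quotmod.

Definition quotmod_scale (r : R) (x : quotmod) : quotmod :=
  \pi_quotmod (r *: repr x).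

Lemma quotmod_eqP (x y : E) : \pi_quotmod x = \pi_quotmod y <-> x - y \in N.
Proof.
rewrite -[x - y \in N]/(x - y \in submod_pred) Quotient.idealrBE.
by split=> /eqP.
Qed.

Lemma quotmod_scaleE r x : quotmod_scale r (\pi x) = \pi_quotmod (r *: x).
Proof.
apply/quotmod_eqP; rewrite -scalerBr; apply: rpredZ.
by apply/quotmod_eqP; rewrite reprK.
Qed.

Lemma quotmod_addE x y : \pi_quotmod (x + y) = \pi x + \pi y.
Proof. exact: Quotient.pi_add. Qed.

Fact quotmod_scaleA a b x :
  quotmod_scale a (quotmod_scale b x) = quotmod_scale (a * b) x.
Proof. by rewrite -[x]reprK !quotmod_scaleE scalerA. Qed.

Fact quotmod_scale1 : left_id 1 quotmod_scale.
Proof. by move=> x; rewrite -[x]reprK quotmod_scaleE scale1r. Qed.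

Fact quotmod_scaleDr : right_distributive quotmod_scale +%R.
Proof.
move=> a x y; rewrite -[x]reprK -[y]reprK -quotmod_addE !quotmod_scaleE.
by rewrite scalerDr quotmod_addE.
Qed.

Fact quotmod_scaleDl x : {morph quotmod_scale^~ x : a b / a + b}.
Proof.
move=> a b /=; rewrite -[x]reprK !quotmod_scaleE.
by rewrite scalerDl quotmod_addE.
Qed.

HB.instance Definition _ := GRing.Zmodule_isLmodule.Build R quotmod
  quotmod_scaleA quotmod_scale1 quotmod_scaleDr quotmod_scaleDl.

End Submodule.

Definition rat_int : {pred rat} := fun x => x \is a Num.int.

Lemma rat_int_closed : zmod_closed rat_int.
Proof. by split=> [|x y]; [exact: rpred0 | exact: rpredB]. Qed.

HB.instance Definition _ := GRing.isZmodClosed.Build rat rat_int rat_int_closed.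

Definition QmodZ : zmodType := Quotient.quot rat_int.

Section CharacterModule.
Variables (R : pzRingType) (F : lmodType R^c).

Definition char_pred : {pred F -> QmodZ} :=
  fun f => `[< {morph f : x y / x + y} >].

Record char_module := CharModule
  {char_val :> F -> QmodZ; _ : char_val \in char_pred}.

Lemma char_pred_closed : zmod_closed char_pred.
Proof.
split=> [|f g /asboolP fD /asboolP gD]; apply/asboolP => x y.
  by rewrite /= addr0.
rewrite -[LHS]/(f (x + y) - g (x + y)) fD gD -[RHS]/(f x - g x + (f y - g y)).
by rewrite opprD addrACA.
Qed.

HB.instance Definition _ := GRing.isZmodClosed.Build (F -> QmodZ) char_pred
  char_pred_closed.
HB.instance Definition _ := [isSub for char_val].
HB.instance Definition _ := [Choice of char_module by <:].
HB.instance Definition _ := [SubChoice_isSubZmodule of char_module by <:].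

Lemma char_scale_proof (r : R) (phi : char_module) :
  (fun x => phi ((r : R^c) *: x)) \in char_pred.
Proof.
apply/asboolP => x y; rewrite scalerDr.
by case: phi => f /= /asboolP ->.
Qed.

Definition char_scale (r : R) (phi : char_module) : char_module :=
  CharModule (char_scale_proof r phi).

Lemma char_moduleP (f g : char_module) : f =1 g -> f = g.
Proof. by move=> fg; apply/val_inj/funext. Qed.

Fact char_scaleA a b phi :
  char_scale a (char_scale b phi) = char_scale (a * b) phi.
Proof. by apply: char_moduleP => x /=; rewrite scalerA. Qed.

Fact char_scale1 : left_id 1 char_scale.
Proof. by move=> phi; apply: char_moduleP => x /=; rewrite scale1r. Qed.

Fact char_scaleDr : right_distributive char_scale +%R.
Proof. by move=> a f g; apply: char_moduleP. Qed.

Fact char_scaleDl phi : {morph char_scale^~ phi : a b / a + b}.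
Proof.
move=> a b; apply: char_moduleP => x; rewrite /= scalerDl.
case: phi => f /= /asboolP fD; exact: fD.
Qed.

HB.instance Definition _ := GRing.Zmodule_isLmodule.Build R char_module
  char_scaleA char_scale1 char_scaleDr char_scaleDl.

End CharacterModule.

Section ModuleNotions.
Variable R : pzRingType.
Implicit Types A B C E F M N P : lmodType R.

Definition exact_at A B C (f : {linear A -> B}) (g : {linear B -> C}) : Prop :=
  forall y, g y = 0 <-> exists x, f x = y.

Definition short_exact A B C
    (i : {linear A -> B}) (p : {linear B -> C}) : Prop :=
  [/\ injective i, exact_at i p & surjective_map p].

Definition flat M : Prop :=
  forall (A B : lmodType R^c) (i : {linear A -> B}), injective i ->
    injective (tensor_map i (idfun : {linear M -> M})).

Definition flat_right (X : lmodType R^c) : Prop :=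
  forall A B (i : {linear A -> B}), injective i ->
    injective (tensor_map (idfun : {linear X -> X}) i).

Definition injective_module E : Prop :=
  forall A B (i : {linear A -> B}), injective i ->
  forall f : {linear A -> E}, exists h : {linear B -> E}, h \o i =1 f.

Definition projective_module P : Prop :=
  forall B C (p : {linear B -> C}), surjective_map p ->
  forall f : {linear P -> C}, exists h : {linear P -> B}, p \o h =1 f.

Definition finitely_presented M : Prop :=
  exists m n (d : {linear 'rV[R]_m -> 'rV[R]_n}) (p : {linear 'rV[R]_n -> M}),
    exact_at d p /\ surjective_map p.

Definition pure A B (i : {linear A -> B}) : Prop :=
  forall X : lmodType R^c, injective (tensor_map (idfun : {linear X -> X}) i).

Definition pure_projective P : Prop :=
  forall A B C (i : {linear A -> B}) (p : {linear B -> C}),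
    short_exact i p -> pure i ->
  forall f : {linear P -> C}, exists h : {linear P -> B}, p \o h =1 f.

(* Ext^1(M, N) = 0: the complex Hom(P_0, N) -> Hom(P_1, N) -> Hom(P_2, N)
   obtained from a projective resolution of M is exact in the middle.  Only the
   terms of the resolution in degrees at most 2 matter. *)
Definition Ext1_eq0 M N : Prop :=
  forall P2 P1 P0 (d2 : {linear P2 -> P1}) (d1 : {linear P1 -> P0})
      (e : {linear P0 -> M}),
    projective_module P2 -> projective_module P1 -> projective_module P0 ->
    exact_at d2 d1 -> exact_at d1 e -> surjective_map e ->
  forall f : {linear P1 -> N}, (forall x, f (d2 x) = 0) ->
  exists h : {linear P0 -> N}, h \o d1 =1 f.

Definition FP_injective N : Prop :=
  forall F, finitely_presented F -> Ext1_eq0 F N.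

Definition embeds_in_flat M : Prop :=
  exists F (i : {linear M -> F}), flat F /\ injective i.

Definition flat_precover F N (g : {linear F -> N}) : Prop :=
  flat F /\
  forall F', flat F' ->
  forall f : {linear F' -> N}, exists h : {linear F' -> F}, g \o h =1 f.

Definition flat_precover_completing_domain M N : Prop :=
  forall (f : {linear M -> N}) F (g : {linear F -> N}), flat_precover g ->
  exists h : {linear M -> F}, g \o h =1 f.

Definition f_rugged M : Prop :=
  forall N, flat_precover_completing_domain M N <-> flat N.

End ModuleNotions.

Definition IF_ring (R : pzRingType) : Prop :=
  forall E : lmodType R, injective_module E -> flat E.

(* Main.v *)
(* A module is flat if and only if its finite linear relations are trivial,
   hence if and only if every map to it from a finitely presented module factors
   through a flat module.  A map from a finitely presented module to an
   injective module extends along any embedding in a flat module: this is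
   (4) => (1).  Condition (5) enters because [F^+] is injective when [F] is flat
   and every module embeds in [F^+] for some free [F], so that every injective
   module is a summand of such an [F^+].  Condition (7) enters because an
   FP-injective submodule is pure and the quotient of a flat module by a pure
   submodule is flat.

   For (8), the direct sum of all finitely presented modules is f-rugged as soon
   as every module [N] has a flat precover.  A map [F -> N] from a flat module
   factors through the quotient of [F] by a maximal pure submodule of its
   kernel, which is flat.  No nonzero pure submodule of this quotient is killed
   by the map to [N], and this bounds the quotient: its elements are named by
   terms from a type that only depends on [N].  A direct sum over a set of flat
   modules is then a flat precover. *)
Require Import Defs.
From HB Require Import structures.
From mathcomp Require Import all_boot all_order all_algebra finmap.
From mathcomp Require Import boolp classical_sets functions fsbigop.
Set Implicit Arguments.
Unset Strict Implicit.
Unset Printing Implicit Defensive.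
Import Order.TTheory GRing.Theory Num.Theory.
Local Open Scope ring_scope.
Local Open Scope quotient_scope.
Local Open Scope classical_set_scope.

(** * Subgroups, submodules and linear maps *)

Definition additive_of (A B : zmodType) (f : A -> B) (f_add : zmod_morphism f) :
    {additive A -> B} :=
  HB.pack f (GRing.isZmodMorphism.Build A B f f_add).

Section Subgroups.
Variable V : zmodType.

Definition is_subgroup (P : set V) : Prop :=
  P 0 /\ forall x y, P x -> P y -> P (x - y).

Variables (P : set V) (Psub : is_subgroup P).

Let pred_of_P : {pred V} := fun x => `[< P x >].

Fact subgroup_of_closed : zmod_closed pred_of_P.
Proof.
case: Psub => P0 PB; split=> [|x y /asboolP Px /asboolP Py]; apply/asboolP.
  exact: P0.
exact: PB.
Qed.

Definition subgroup_of : zmodClosed V :=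
  HB.pack pred_of_P (GRing.isZmodClosed.Build V pred_of_P subgroup_of_closed).

Lemma subgroup_ofP x : reflect (P x) (x \in subgroup_of).
Proof. exact: asboolP. Qed.

Lemma is_subgroup_mulrz x (n : int) : P x -> P (x *~ n).
Proof. by move=> /subgroup_ofP Px; apply/subgroup_ofP; exact: rpredMz. Qed.

End Subgroups.

Section Linear.
Variable R : pzRingType.
Implicit Types A B C M N : lmodType R.

Definition linear_of A B (f : A -> B) (f_lin : linear f) : {linear A -> B} :=
  HB.pack f (GRing.isLinear.Build R A B *:%R f f_lin).

Definition is_submod M (P : set M) : Prop :=
  P 0 /\ forall (r : R) x y, P x -> P y -> P (r *: x + y).

Lemma is_submod_ker M N (f : {linear M -> N}) : is_submod [set x | f x = 0].
Proof.
split=> [|r x y /= fx0 fy0]; first exact: linear0.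
by rewrite linearP fx0 fy0 scaler0 addr0.
Qed.

Lemma is_submod_range M N (f : {linear M -> N}) : is_submod (range f).
Proof.
split=> [|r _ _ [x _ <-] [x' _ <-]]; first by exists 0; rewrite ?linear0.
by exists (r *: x + x'); rewrite ?linearP.
Qed.

Lemma is_submod_preimage M N (f : {linear M -> N}) (P : set N) :
  is_submod P -> is_submod (f @^-1` P).
Proof.
move=> [P0 PD]; split=> [|r x y]; first by rewrite /= linear0.
by rewrite /= linearP; exact: PD.
Qed.

Section SubmodOf.
Variables (M : lmodType R) (P : set M) (Psub : is_submod P).

Let pred_of_P : {pred M} := fun x => `[< P x >].

Fact submod_of_closed : GRing.submod_closed pred_of_P.
Proof.
case: Psub => P0 PD; split=> [|r x y /asboolP Px /asboolP Py]; apply/asboolP.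
  exact: P0.
exact: PD.
Qed.

Definition submod_of : submodClosed M :=
  HB.pack pred_of_P
    (GRing.isSubmodClosed.Build R M pred_of_P submod_of_closed).

Lemma submod_ofP x : reflect (P x) (x \in submod_of).
Proof. exact: asboolP. Qed.

End SubmodOf.

Definition lin_ker M N (f : {linear M -> N}) : submodClosed M :=
  submod_of (is_submod_ker f).

Definition lin_range M N (f : {linear M -> N}) : submodClosed N :=
  submod_of (is_submod_range f).

Definition submod_incl M (N : submodClosed M) : {linear submod N -> M} :=
  linear_of (fun r x y => erefl : submod_val (r *: x + y) = _).

Lemma submod_incl_inj M (N : submodClosed M) : injective (@submod_incl M N).
Proof. exact: val_inj. Qed.

Fact quotmod_proj_linear M (N : submodClosed M) :
  linear (fun x => \pi_(quotmod N) x).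
Proof. by move=> r x y; rewrite quotmod_addE -quotmod_scaleE. Qed.

Definition quotmod_proj M (N : submodClosed M) : {linear M -> quotmod N} :=
  linear_of (@quotmod_proj_linear M N).

Lemma quotmod_proj_eq0 M (N : submodClosed M) x :
  quotmod_proj N x = 0 <-> x \in N.
Proof.
rewrite -(linear0 (quotmod_proj N)).
by split=> [/quotmod_eqP|xN]; [|apply/quotmod_eqP]; rewrite subr0.
Qed.

Lemma quotmod_proj_of_eq0 M (P : set M) (Psub : is_submod P) x :
  quotmod_proj (submod_of Psub) x = 0 <-> P x.
Proof.
split=> [/quotmod_proj_eq0/submod_ofP //|Px].
exact/quotmod_proj_eq0/submod_ofP.
Qed.

Lemma quotmod_proj_surj M (N : submodClosed M) :
  surjective_map (quotmod_proj N).
Proof. by move=> x; exists (repr x); exact: reprK. Qed.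

Lemma linear_factor A B C (p : {linear A -> B}) (q : {linear A -> C}) :
  surjective_map p -> (forall x, p x = 0 -> q x = 0) ->
  exists h : {linear B -> C}, h \o p =1 q.
Proof.
move=> /choice[s sK] pq.
have q_s x : q (s (p x)) = q x.
  by apply/eqP; rewrite -subr_eq0 -linearB; apply/eqP/pq;
    rewrite linearB sK subrr.
have h_lin : linear (q \o s).
  by move=> r x y /=; rewrite -linearP -[RHS]q_s linearP !sK.
by exists (linear_of h_lin).
Qed.

Lemma linear_lift A B C (i : {linear B -> C}) (f : {linear A -> C}) :
  injective i -> (forall x, range i (f x)) ->
  exists h : {linear A -> B}, i \o h =1 f.
Proof.
move=> i_inj fi.
have /choice[s sK] x : exists y, i y = f x by have [y _] := fi x; exists y.
have s_lin : linear s.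
  by move=> r x y; apply: i_inj; rewrite linearP !sK linearP.
by exists (linear_of s_lin).
Qed.

Lemma lin_range_factor A B (f : {linear A -> B}) :
  exists2 f' : {linear A -> submod (lin_range f)},
    submod_incl (lin_range f) \o f' =1 f & surjective_map f'.
Proof.
have [|f' f'E] := linear_lift (f := f) (@submod_incl_inj _ (lin_range f)).
  move=> x; have fx : f x \in lin_range f by apply/submod_ofP; exists x.
  by exists (Submod fx).
exists f' => // -[y yf]; have /submod_ofP[x _ xE] := yf; exists x.
by apply: submod_incl_inj; rewrite [LHS]f'E.
Qed.

Lemma quotmod_ker_iso A B (p : {linear A -> B}) : surjective_map p ->
  exists (i : {linear quotmod (lin_ker p) -> B})
    (j : {linear B -> quotmod (lin_ker p)}), cancel i j /\ cancel j i.
Proof.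
move=> p_surj; have pr_surj := @quotmod_proj_surj A (lin_ker p).
have [x /quotmod_proj_of_eq0//|i iE] := linear_factor (q := p) pr_surj.
have [|j jE] := linear_factor (q := quotmod_proj (lin_ker p)) p_surj.
  by move=> x px0; apply/quotmod_proj_of_eq0.
exists i, j; split=> [x|y].
  by have [a <-] := pr_surj x; rewrite [i _]iE [LHS]jE.
by have [a <-] := p_surj y; rewrite [j _]jE [LHS]iE.
Qed.

End Linear.

(** * Matrices acting on tuples *)

Definition mxact (R : pzRingType) (M : lmodType R) m l (S : 'M[R]_(m, l))
    (e : 'I_l -> M) : 'I_m -> M :=
  fun j => \sum_k S j k *: e k.

Local Notation "S '*v' e" := (mxact S e) (at level 40, left associativity).

Section MatrixAction.
Variable R : pzRingType.
Implicit Types M N : lmodType R.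

Fact mxactB M m l (S : 'M[R]_(m, l)) :
  zmod_morphism (mxact S : ('I_l -> M) -> 'I_m -> M).
Proof.
move=> e e'; apply/funext => j.
rewrite -[RHS]/(\sum_k S j k *: e k - \sum_k S j k *: e' k) -sumrB.
by apply: eq_bigr => k _; rewrite -scalerBr.
Qed.

HB.instance Definition _ M m l (S : 'M[R]_(m, l)) :=
  GRing.isZmodMorphism.Build ('I_l -> M) ('I_m -> M) (mxact S) (mxactB S).

Lemma mxactA M m n l (S : 'M[R]_(m, n)) (T : 'M[R]_(n, l)) (e : 'I_l -> M) :
  S *v (T *v e) = (S *m T) *v e.
Proof.
apply/funext => j; rewrite /mxact; under eq_bigr do rewrite scaler_sumr.
rewrite exchange_big; apply: eq_bigr => k _; rewrite mxE scaler_suml.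
by apply: eq_bigr => t _; rewrite scalerA.
Qed.

Lemma linear_mxactE M N (f : {linear M -> N}) m l (S : 'M[R]_(m, l))
    (e : 'I_l -> M) j :
  f ((S *v e) j) = (S *v (f \o e)) j.
Proof. by rewrite linear_sum; apply: eq_bigr => k _; rewrite linearZ. Qed.

Lemma linear_mxact M N (f : {linear M -> N}) m l (S : 'M[R]_(m, l))
    (e : 'I_l -> M) :
  f \o (S *v e) = S *v (f \o e).
Proof. by apply/funext => j; exact: linear_mxactE. Qed.

Lemma mxact_linear_eq0 M N (f : {linear M -> N}) m l (S : 'M[R]_(m, l))
    (e : 'I_l -> M) :
  S *v e = 0 -> S *v (f \o e) = 0.
Proof.
by move=> Se0; apply/funext => j; rewrite -linear_mxactE Se0 [LHS]linear0.
Qed.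

Fact lincomb_linear M l (e : 'I_l -> M) :
  linear (fun v : 'rV[R]_l => (v *v e) 0).
Proof.
move=> r x y; rewrite /mxact scaler_sumr -big_split /=; apply: eq_bigr => k _.
by rewrite !mxE scalerDl scalerA.
Qed.

Definition lincomb M l (e : 'I_l -> M) : {linear 'rV[R]_l -> M} :=
  linear_of (lincomb_linear e).

Lemma lincomb_delta M l (e : 'I_l -> M) k : lincomb e 'e_k = e k.
Proof.
rewrite /= /mxact (bigD1 k) //= mxE !eqxx scale1r big1 ?addr0 // => j jk.
by rewrite mxE (negPf jk) scale0r.
Qed.

Lemma linear_lincomb M N (f : {linear M -> N}) l (e : 'I_l -> M) v :
  f (lincomb e v) = lincomb (f \o e) v.
Proof. by rewrite /= -linear_mxact. Qed.

Lemma mxact_delta m l (S : 'M[R]_(m, l)) j : (S *v (fun k => 'e_k)) j = row j S.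
Proof. by rewrite [RHS]row_sum_delta; apply: eq_bigr => k _; rewrite mxE. Qed.

Lemma linear_rowE M l (f : {linear 'rV[R]_l -> M}) :
  f =1 lincomb (fun k => f 'e_k).
Proof.
move=> v; rewrite {1}(row_sum_delta v) linear_sum.
by apply: eq_bigr => k _; rewrite linearZ.
Qed.

Lemma lincomb_mulmx M m l (e : 'I_l -> M) (S : 'M[R]_(m, l)) v :
  lincomb e (v *m S) = lincomb (S *v e) v.
Proof. by rewrite /= mxactA. Qed.

Lemma lincombB M l (e e' : 'I_l -> M) v :
  lincomb (e - e') v = lincomb e v - lincomb e' v.
Proof. by rewrite /= raddfB. Qed.

Lemma lincomb0 M l v : lincomb (0 : 'I_l -> M) v = 0.
Proof. by rewrite /= /mxact big1 // => k _; exact: scaler0. Qed.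

Lemma row_projective l : projective_module 'rV[R]_l.
Proof.
move=> B C p /choice[s sK] f; exists (lincomb (fun k => s (f 'e_k))) => v.
rewrite [LHS]linear_lincomb [RHS]linear_rowE; congr (lincomb _ v).
by apply/funext => k; exact: sK.
Qed.

Definition scale_row M l (c : 'rV[R]_l) (y : M) : 'I_l -> M :=
  fun k => c 0 k *: y.

Lemma sum_scale_delta M l (e : 'I_l -> M) : \sum_k scale_row 'e_k (e k) = e.
Proof.
apply/funext => j; rewrite fct_sumE -[RHS]lincomb_delta.
by apply: eq_bigr => k _; rewrite /scale_row !mxE eq_sym.
Qed.

Lemma mxact_scale_row M m l (S : 'M[R]_(m, l)) c (y : M) :
  S *v scale_row c y = scale_row (S *m c^T)^T y.
Proof.
apply/funext => j; rewrite /scale_row !mxE scaler_suml.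
by apply: eq_bigr => k _; rewrite scalerA mxE.
Qed.

Definition row_span M l (Z : set 'rV[R]_l) : set ('I_l -> M) :=
  [set e | exists2 w : seq ('rV[R]_l * M),
    forall p, p \in w -> Z p.1 & e = \sum_(p <- w) scale_row p.1 p.2].

Lemma mem_row_span M l (Z : set 'rV[R]_l) c (y : M) :
  Z c -> row_span Z (scale_row c y).
Proof.
by move=> Zc; exists [:: (c, y)] => [p|]; rewrite ?big_seq1 ?inE // => /eqP ->.
Qed.

Lemma is_subgroup_row_span M l (Z : set 'rV[R]_l) :
  is_subgroup (@row_span M l Z).
Proof.
split=> [|_ _ [w Zw ->] [w' Zw' ->]]; first by exists [::]; rewrite ?big_nil.
exists (w ++ [seq (p.1, - p.2) | p <- w']) => [p|].
  by rewrite mem_cat => /orP[/Zw|/mapP[q /Zw' Zq ->]].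
rewrite big_cat big_map -sumrN; congr (_ + _); apply: eq_bigr => p _.
by apply/funext => k; rewrite /scale_row scalerN.
Qed.

Lemma row_span_linear M N (f : {linear M -> N}) l (Z : set 'rV[R]_l)
    (e : 'I_l -> M) :
  row_span Z e -> row_span Z (f \o e).
Proof.
move=> [w Zw ->]; exists [seq (p.1, f p.2) | p <- w] => [p|].
  by move=> /mapP[q /Zw Zq ->].
rewrite big_map; apply/funext => k; rewrite /= !fct_sumE linear_sum.
by apply: eq_bigr => p _; rewrite /scale_row linearZ.
Qed.

End MatrixAction.

(** * Vanishing of tensors *)

Section PureTensor.
Variables (R : pzRingType) (A : lmodType R^c) (E : lmodType R).
Implicit Types (a : A) (e : E) (r : R).

Lemma pure_tensorDl a a' e :
  pure_tensor (a + a') e = pure_tensor a e + pure_tensor a' e.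
Proof. by have [+ _ _] := pure_tensor_balanced A E; apply. Qed.

Lemma pure_tensorDr a e e' :
  pure_tensor a (e + e') = pure_tensor a e + pure_tensor a e'.
Proof. by have [_ + _] := pure_tensor_balanced A E; apply. Qed.

Lemma pure_tensorZ r a e :
  pure_tensor ((r : R^c) *: a) e = pure_tensor a (r *: e).
Proof. by have [_ _ +] := pure_tensor_balanced A E; apply. Qed.

Lemma pure_tensor0l e : pure_tensor (0 : A) e = 0.
Proof. by apply: (addrI (pure_tensor 0 e)); rewrite -pure_tensorDl !addr0. Qed.

Lemma pure_tensor0r a : pure_tensor a (0 : E) = 0.
Proof. by apply: (addrI (pure_tensor a 0)); rewrite -pure_tensorDr !addr0. Qed.

Lemma pure_tensorBl a a' e :
  pure_tensor (a - a') e = pure_tensor a e - pure_tensor a' e.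
Proof.
by apply: (addIr (pure_tensor a' e)); rewrite -pure_tensorDl !subrK.
Qed.

Lemma pure_tensor_suml (I : Type) (s : seq I) (F : I -> A) e :
  pure_tensor (\sum_(i <- s) F i) e = \sum_(i <- s) pure_tensor (F i) e.
Proof.
apply: (big_morph (fun a => pure_tensor a e)); last exact: pure_tensor0l.
by move=> a a'; exact: pure_tensorDl.
Qed.

Lemma pure_tensor_sumr (I : Type) (s : seq I) (F : I -> E) a :
  pure_tensor a (\sum_(i <- s) F i) = \sum_(i <- s) pure_tensor a (F i).
Proof. exact: (big_morph _ (pure_tensorDr a) (pure_tensor0r a)). Qed.

Lemma pure_tensor_mxact m l (S : 'M[R]_(m, l)) (a : 'I_m -> A) (e : 'I_l -> E) :
  \sum_j pure_tensor (a j) ((S *v e) j) =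
  \sum_k pure_tensor (((S^T : 'M[R^c]_(l, m)) *v a) k) (e k).
Proof.
under eq_bigr do rewrite pure_tensor_sumr.
under [RHS]eq_bigr do rewrite pure_tensor_suml.
rewrite exchange_big; apply: eq_bigr => k _; apply: eq_bigr => j _.
by rewrite mxE pure_tensorZ.
Qed.

Lemma tensor_additive_ext (G : zmodType) (f g : {additive tensor A E -> G}) :
  (forall a e, f (pure_tensor a e) = g (pure_tensor a e)) -> f =1 g.
Proof.
move=> fg u; rewrite -[u]reprK tensor_sumE !raddf_sum.
by apply: eq_bigr => p _; exact: fg.
Qed.

Definition tensor_lift (G : zmodType) (b : A -> E -> G) (b_bal : balanced b) :
    {additive tensor A E -> G} :=
  s2val (cid2 (tensor_universal b_bal)).

Lemma tensor_liftE (G : zmodType) (b : A -> E -> G) (b_bal : balanced b) a e :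
  tensor_lift b_bal (pure_tensor a e) = b a e.
Proof. by rewrite /tensor_lift; case: cid2. Qed.

End PureTensor.

Section VanishingTensors.
Variables (R : pzRingType) (A : lmodType R^c) (E : lmodType R) (l : nat).
Variable p : {linear 'rV[R^c]_l -> A}.
Hypothesis p_surj : surjective_map p.

Let Z : set 'rV[R]_l := [set c : 'rV[R^c]_l | p c = 0].
Let span_Z : zmodClosed ('I_l -> E) := subgroup_of (is_subgroup_row_span E Z).
Let Q : zmodType := Quotient.quot span_Z.

Let pi_eq (u v : 'I_l -> E) : row_span Z (u - v) -> \pi_Q u = \pi_Q v.
Proof.
by move=> uv; apply/eqP; rewrite -Quotient.idealrBE; exact/subgroup_ofP.
Qed.

Let pi_scale_row (c d : 'rV[R^c]_l) (x : E) :
  p c = p d ->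
  \pi_Q (scale_row (c : 'rV[R]_l) x) = \pi_Q (scale_row (d : 'rV[R]_l) x).
Proof.
move=> cd; apply: pi_eq.
have -> : scale_row (c : 'rV[R]_l) x - scale_row (d : 'rV[R]_l) x =
    scale_row (c - d : 'rV[R]_l) x.
  by apply/funext => k; rewrite /scale_row !mxE scalerBl.
by apply: mem_row_span; rewrite /Z /= linearB cd subrr.
Qed.

(* The tensor product of [A] and [E] is the quotient of [E^l] by the span of the
   kernel of [p]. *)
Lemma tensor_eq0_row_span (e : 'I_l -> E) :
  \sum_k pure_tensor (p 'e_k) (e k) = 0 -> row_span Z e.
Proof.
have [s sK] := choice p_surj.
pose b (a : A) (x : E) : Q := \pi_Q (scale_row (s a : 'rV[R]_l) x).
have b_bal : balanced b.
  split=> [a a' x|a x x'|r a x]; rewrite /b -?raddfD.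
  - rewrite (pi_scale_row (d := s a + s a')); last by rewrite linearD !sK.
    by congr (\pi_Q _); apply/funext => k; rewrite /scale_row mxE scalerDl.
  - by congr (\pi_Q _); apply/funext => k; rewrite /scale_row scalerDr.
  - rewrite (pi_scale_row (d := (r : R^c) *: s a)).
      by congr (\pi_Q _); apply/funext => k; rewrite /scale_row mxE scalerA.
    by rewrite linearZ /= !sK.
move=> /(congr1 (tensor_lift b_bal)); rewrite raddf0 raddf_sum.
under eq_bigr => k _
  do rewrite tensor_liftE [b _ _](pi_scale_row (d := 'e_k)) ?sK //.
rewrite -raddf_sum sum_scale_delta => /eqP.
by rewrite -(raddf0 \pi_Q) -Quotient.idealrBE subr0 => /subgroup_ofP.
Qed.

End VanishingTensors.

(** * The equational criteria for flatness and purity *)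

Section EquationalCriteria.
Variable R : pzRingType.
Implicit Types M N E : lmodType R.

Lemma row_spanS M l (Y Z : set 'rV[R]_l) (e : 'I_l -> M) :
  Y `<=` Z -> row_span Y e -> row_span Z e.
Proof. by move=> YZ [w wY ->]; exists w => // p /wY/YZ. Qed.

(* In the usual form [e = X y] with [S X = 0], the columns of [X] are the
   transposes of the rows [c]. *)
Definition trivial_relation M m l (S : 'M[R]_(m, l)) (e : 'I_l -> M) : Prop :=
  row_span [set c : 'rV[R]_l | S *m c^T = 0] e.

Definition equationally_flat M : Prop :=
  forall m l (S : 'M[R]_(m, l)) (e : 'I_l -> M),
    S *v e = 0 -> trivial_relation S e.

Definition equationally_pure M (P : set M) : Prop :=
  forall m l (S : 'M[R]_(m, l)) (b : 'I_l -> M), (forall j, P ((S *v b) j)) ->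
  exists2 a : 'I_l -> M, forall k, P (a k) & S *v a = S *v b.

Lemma flat_equationally_flat E : flat E -> equationally_flat E.
Proof.
move=> flE m l S e Se0.
pose d := mulmxr (S^T : 'M[R^c]_(l, m)) : {linear 'rV[R^c]_l -> 'rV[R^c]_m}.
have [d' d'E d'_surj] := lin_range_factor d.
apply: row_spanS (_ : [set c : 'rV[R^c]_l | d' c = 0] `<=` _) _.
  move=> c /= d'c0; apply: trmx_inj; rewrite trmx_mul_rev trmxK trmx0.
  by rewrite -[LHS]/(d c) -d'E -[LHS]/(submod_incl _ (d' c)) d'c0 linear0.
apply: tensor_eq0_row_span d'_surj _ _.
apply: (flE _ _ _ (@submod_incl_inj R^c _ (lin_range d))).
rewrite raddf0 raddf_sum; transitivity (\sum_k pure_tensor (d 'e_k) (e k)).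
  by apply: eq_bigr => k _; rewrite [LHS]tensor_map_pure -d'E.
under eq_bigr do rewrite [d _]/= -rowE -mxact_delta.
by rewrite -pure_tensor_mxact Se0 big1 // => j _; exact: pure_tensor0r.
Qed.

Lemma pure_equationally_pure M N (i : {linear M -> N}) :
  pure i -> equationally_pure (range i).
Proof.
move=> pui m l S b ib; pose D := (S^T : 'M[R^c]_(l, m)).
have /choice[a aE] j : exists x, i x = (S *v b) j.
  by have [x _] := ib j; exists x.
pose d := mulmxr D : {linear 'rV[R^c]_l -> 'rV[R^c]_m}.
pose p := quotmod_proj (lin_range d).
have Dp0 : D *v (p \o (fun j => 'e_j)) = 0.
  rewrite -linear_mxact; apply/funext => k; apply/quotmod_proj_of_eq0.
  by exists 'e_k; rewrite //= mxact_delta rowE.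
have [|w wp aw] := tensor_eq0_row_span (@quotmod_proj_surj _ _ (lin_range d))
    (e := a).
  apply: (pui (quotmod (lin_range d))).
  rewrite raddf0 raddf_sum.
  transitivity (\sum_j pure_tensor (p 'e_j) ((S *v b) j)).
    by apply: eq_bigr => j _; rewrite [LHS]tensor_map_pure -aE.
  rewrite pure_tensor_mxact -/D Dp0 big1 // => k _; exact: pure_tensor0l.
have /choice[v vE] (c : 'rV[R^c]_m) : exists v : 'rV[R^c]_l,
    p c = 0 -> v *m D = c.
  have [/quotmod_proj_of_eq0[v _ vc]|npc0] := pselect (p c = 0).
    by exists v.
  by exists 0.
pose a' : 'I_l -> M := \sum_(q <- w) scale_row (v q.1 : 'rV[R]_l) q.2.
have Sa' : S *v a' = a.
  rewrite raddf_sum aw; apply: eq_big_seq => q qw /=.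
  by rewrite mxact_scale_row trmx_mul_rev trmxK vE //; exact: wp.
exists (i \o a') => [k|]; first by exists (a' k).
by rewrite -linear_mxact Sa'; apply/funext => j; exact: aE.
Qed.

Lemma trivial_relation_linear M N (f : {linear M -> N}) m l (S : 'M[R]_(m, l))
    (e : 'I_l -> M) :
  trivial_relation S e -> trivial_relation S (f \o e).
Proof. exact: row_span_linear. Qed.

(* Here a linear relation among vectors is the list of its terms [r *: z]. *)
Definition satisfies E N (W : seq (seq (R * E))) (x : E -> N) : Prop :=
  forall w, w \in W -> \sum_(p <- w) p.1 *: x p.2 = 0.

Lemma satisfies_cat E N (W W' : seq (seq (R * E))) (x : E -> N) :
  satisfies (W ++ W') x <-> satisfies W x /\ satisfies W' x.
Proof.
split=> [WW'x|[Wx W'x] w]; last by rewrite mem_cat => /orP[/Wx|/W'x].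
by split=> w wW; apply: WW'x; rewrite mem_cat wW ?orbT.
Qed.

Lemma satisfies_mx E (U : seq E) (W : seq (seq (R * E))) :
  exists m l (S : 'M[R]_(m, l)) (e : 'I_l -> E),
    [/\ injective e, forall z, z \in U -> exists k, e k = z &
      forall N (x : E -> N), satisfies W x <-> S *v (x \o e) = 0].
Proof.
pose V := undup (U ++ flatten (map (map snd) W)).
pose e (k : 'I_(size V)) := nth 0 V k.
have e_inj : injective e.
  move=> j k /eqP; rewrite nth_uniq ?undup_uniq ?ltn_ord // => /eqP.
  exact: val_inj.
have eP z : z \in V -> exists k, e k = z.
  by move=> /(nthP 0)[k ltkV <-]; exists (Ordinal ltkV).
have VW w p : w \in W -> p \in w -> exists k, e k = p.2.
  move=> wW pw; apply: eP; rewrite mem_undup mem_cat; apply/orP; right.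
  by apply/flattenP; exists (map snd w); rewrite ?map_f.
pose S := \matrix_(j < size W, k < size V)
  \sum_(p <- nth [::] W j | e k == p.2) p.1.
have SE N (x : E -> N) j :
    (S *v (x \o e)) j = \sum_(p <- nth [::] W j) p.1 *: x p.2.
  have wW : nth [::] W j \in W by exact: mem_nth.
  rewrite /mxact; under eq_bigr do rewrite mxE scaler_suml big_mkcond.
  rewrite exchange_big; apply: eq_big_seq => p /(VW _ _ wW)[k <-].
  by rewrite -big_mkcond (big_pred1 k) // => k'; rewrite inj_eq.
exists (size W), (size V), S, e; split=> // [z zU|N x].
  by apply: eP; rewrite mem_undup mem_cat zU.
split=> [Wx|Sx0 _ /(nthP [::])[j ltjW <-]].
  by apply/funext => j; rewrite SE; exact/Wx/mem_nth.
by rewrite -(SE _ _ (Ordinal ltjW)) Sx0.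
Qed.

Lemma equationally_flat_coordinates E (U : seq E) (W : seq (seq (R * E))) :
  equationally_flat E -> satisfies W (id : E -> E) ->
  exists2 Y : seq ((E -> R^o) * E),
    forall z, z \in U -> z = \sum_(q <- Y) (q.1 z : R) *: q.2 &
    forall q, q \in Y -> satisfies W q.1.
Proof.
move=> flE; have [m [l [S [e [e_inj eU WS]]]]] := satisfies_mx U W.
move=> /WS/flE[Y SY eY].
pose x (c : 'rV[R]_l) z : R^o := \sum_(k | e k == z) c 0 k.
have xe c : x c \o e = c 0.
  by apply/funext => k; rewrite /= /x (big_pred1 k) // => k'; rewrite inj_eq.
exists [seq (x q.1, q.2) | q <- Y] => [z /eU[k <-]|_ /mapP[q /SY Sq0 ->]].
  rewrite big_map -[LHS]/((id \o e) k) eY fct_sumE; apply: eq_bigr => q _.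
  by rewrite /scale_row -xe.
apply/WS; rewrite xe; apply/funext => j.
have := congr1 (fun c : 'cV_m => c j 0) Sq0; rewrite !mxE => Sq0j.
by rewrite -[RHS]Sq0j; apply: eq_bigr => k _; rewrite mxE.
Qed.

End EquationalCriteria.

Section TensorRelations.
Variables (R : pzRingType) (A : lmodType R^c) (E : lmodType R).

(* An equality of tensors only uses finitely many linear relations between
   elements of [E]. *)
Lemma tensor_eq_relations (s t : seq (A * E)) : tensor_eq s t ->
  exists2 W : seq (seq (R * E)),
    satisfies W (id : E -> E) &
    forall x : E -> R^o, satisfies W x ->
      \sum_(p <- s) (x p.2 : R^c) *: p.1 = \sum_(p <- t) (x p.2 : R^c) *: p.1.
Proof.
elim=> {s t} [s|s t _ [W W0 WE]|s t u _ [W W0 WE] _ [W' W'0 W'E]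
  |s s' t t' _ [W W0 WE] _ [W' W'0 W'E]|s t|e|a a' e|a e e'|r a e].
- by exists [::].
- by exists W => // x /WE.
- exists (W ++ W') => [|x /satisfies_cat[/WE -> /W'E //]].
  by apply/satisfies_cat; split.
- exists (W ++ W') => [|x /satisfies_cat[/WE sE /W'E tE]].
    by apply/satisfies_cat; split.
  by rewrite !big_cat sE tE.
- by exists [::] => // x _; rewrite !big_cat /= addrC.
- by exists [::] => // x _; rewrite big_seq1 big_nil scaler0.
- by exists [::] => // x _; rewrite big_seq1 big_cons big_seq1 scalerDr.
- exists [:: [:: (1, e + e'); (-1, e); (-1, e')]] => [w|x Wx].
    rewrite inE => /eqP ->; rewrite !big_cons big_nil /= !scaleN1r scale1r.
    by rewrite addr0 -opprD subrr.
  have := Wx _ (mem_head _ _).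
  rewrite !big_cons !big_nil /= !scaleN1r scale1r !addr0 -opprD => /eqP.
  by rewrite subr_eq0 => /eqP ->; rewrite scalerDl.
- exists [:: [:: (r, e); (-1, r *: e)]] => [w|x Wx].
    rewrite inE => /eqP ->; rewrite !big_cons big_nil /= scaleN1r addr0.
    exact: subrr.
  have := Wx _ (mem_head _ _); rewrite !big_cons !big_nil /= scaleN1r !addr0.
  by move=> /eqP; rewrite subr_eq0 => /eqP <-; rewrite scalerA.
Qed.

End TensorRelations.

Section FlatModules.
Variable R : pzRingType.
Implicit Types B C E F M N P : lmodType R.

Lemma equationally_flat_flat E : equationally_flat E -> flat E.
Proof.
move=> flE A B i i_inj.
suff ker0 u : tensor_map i (idfun : {linear E -> E}) u = 0 -> u = 0.
  exact: raddf_inj.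
rewrite -[u]reprK; move: (repr u) => s {u}.
rewrite tensor_mapE => /tensor_eqP/tensor_eq_relations[W W0 WE].
have [Y sY WY] := equationally_flat_coordinates (map snd s) flE W0.
have s0 q : q \in Y -> \sum_(p <- s) (q.1 p.2 : R^c) *: p.1 = 0.
  move=> qY; apply: i_inj; rewrite linear0 linear_sum.
  have := WE q.1 (WY q qY); rewrite big_map big_nil => {2}<-.
  by apply: eq_bigr => p _; rewrite linearZ.
rewrite tensor_sumE.
transitivity (\sum_(p <- s) \sum_(q <- Y)
    pure_tensor ((q.1 p.2 : R^c) *: p.1) q.2).
  apply: eq_big_seq => p ps; rewrite [in LHS](sY p.2) ?map_f //.
  by rewrite pure_tensor_sumr; apply: eq_bigr => q _; rewrite pure_tensorZ.
rewrite exchange_big big_seq big1 // => q /s0 q0.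
by rewrite -pure_tensor_suml q0 pure_tensor0l.
Qed.

Lemma flatP E : flat E <-> equationally_flat E.
Proof.
by split; [exact: flat_equationally_flat | exact: equationally_flat_flat].
Qed.

Lemma flat_retract M N (i : {linear M -> N}) (r : {linear N -> M}) :
  cancel i r -> flat N -> flat M.
Proof.
move=> iK /flatP flN; apply/flatP => m l S e Se0.
have -> : e = r \o (i \o e) by apply/funext => k /=; rewrite iK.
by apply/trivial_relation_linear/flN/mxact_linear_eq0.
Qed.

Lemma flat_pure_quotient M N (p : {linear M -> N}) : surjective_map p ->
  equationally_pure [set x | p x = 0] -> flat M -> flat N.
Proof.
move=> /choice[s sK] pup /flatP flM; apply/flatP => m l S e Se0.
have spE : p \o (s \o e) = e by apply/funext => k; exact: sK.
have [j|a pa0 Sa] := pup _ _ S (s \o e).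
  by rewrite /= linear_mxactE spE Se0.
have -> : e = p \o (s \o e - a).
  by apply/funext => k; rewrite /= linearB pa0 subr0 sK.
by apply/trivial_relation_linear/flM; rewrite mxactB Sa subrr.
Qed.

Definition cokermod m l (S : 'M[R]_(m, l)) : lmodType R :=
  quotmod (lin_range (mulmxr S : {linear 'rV[R]_m -> 'rV[R]_l})).

Definition cokermod_proj m l (S : 'M[R]_(m, l)) :
    {linear 'rV[R]_l -> cokermod S} :=
  quotmod_proj _.

Lemma cokermod_proj_surj m l (S : 'M[R]_(m, l)) :
  surjective_map (cokermod_proj S).
Proof. exact: quotmod_proj_surj. Qed.

Lemma cokermod_exact m l (S : 'M[R]_(m, l)) :
  exact_at (mulmxr S : {linear 'rV[R]_m -> 'rV[R]_l}) (cokermod_proj S).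
Proof.
move=> v; split=> [/quotmod_proj_of_eq0[w _ <-]|[w <-]]; first by exists w.
by apply/quotmod_proj_of_eq0; exists w.
Qed.

Lemma finitely_presented_cokermod m l (S : 'M[R]_(m, l)) :
  finitely_presented (cokermod S).
Proof.
exists m, l, (mulmxr S : {linear _ -> _}), (cokermod_proj S).
by split; [exact: cokermod_exact | exact: cokermod_proj_surj].
Qed.

Lemma cokermod_relation m l (S : 'M[R]_(m, l)) :
  S *v (fun k => cokermod_proj S 'e_k) = 0.
Proof.
rewrite -[LHS](linear_mxact (cokermod_proj S) S (fun k => 'e_k)).
apply/funext => j; apply/cokermod_exact; exists 'e_j.
by rewrite mxact_delta rowE.
Qed.

Lemma cokermod_lift M m l (S : 'M[R]_(m, l)) (e : 'I_l -> M) : S *v e = 0 ->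
  exists phi : {linear cokermod S -> M},
    forall k, phi (cokermod_proj S 'e_k) = e k.
Proof.
move=> Se0.
have [v /cokermod_exact[w <-]|phi phiE] :=
    linear_factor (q := lincomb e) (@cokermod_proj_surj _ _ S).
  by rewrite -[LHS]/(lincomb e (w *m S)) lincomb_mulmx Se0 lincomb0.
by exists phi => k; rewrite -(lincomb_delta e) -phiE.
Qed.

Lemma flat_of_fp_factor N :
  (forall m l (S : 'M[R]_(m, l)) (phi : {linear cokermod S -> N}),
    exists F (g : {linear F -> N}) (h : {linear cokermod S -> F}),
      flat F /\ g \o h =1 phi) ->
  flat N.
Proof.
move=> factor; apply/flatP => m l S e /cokermod_lift[phi phiE].
have [F [g [h [/flatP flF ghE]]]] := factor _ _ S phi.
pose x k := cokermod_proj S 'e_k.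
have -> : e = g \o (h \o x) by apply/funext => k; rewrite -phiE -ghE.
apply/trivial_relation_linear/flF/mxact_linear_eq0.
exact: cokermod_relation.
Qed.

Lemma finitely_presented_pure_lift P B C (q : {linear B -> C}) :
  finitely_presented P -> surjective_map q ->
  equationally_pure [set x | q x = 0] ->
  forall f : {linear P -> C}, exists h : {linear P -> B}, q \o h =1 f.
Proof.
move=> [m [l [d [p [dp p_surj]]]]] /choice[s sK] puq f.
pose S := lin1_mx d; pose b k := s (f (p 'e_k)).
have qb v : q (lincomb b v) = f (p v).
  rewrite linear_lincomb (linear_rowE p) linear_lincomb; congr (lincomb _ v).
  by apply/funext => k; exact: sK.
have [j|a qa0 Sa] := puq _ _ S b.
  rewrite /= -(lincomb_delta (S *v b)) -lincomb_mulmx qb mul_rV_lin1.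
  by rewrite (proj2 (dp _)) ?linear0 //; exists 'e_j.
have [x /dp[w <-]|h hE] := linear_factor (q := lincomb (b - a)) p_surj.
  by rewrite -mul_rV_lin1 lincomb_mulmx mxactB Sa subrr lincomb0.
exists h => y; have [v <-] := p_surj y.
rewrite /= [h _]hE lincombB linearB qb (linear_lincomb q a).
by rewrite (_ : q \o a = 0) ?lincomb0 ?subr0 //; apply/funext => k; exact: qa0.
Qed.

Lemma finitely_presented_pure_projective P :
  finitely_presented P -> pure_projective P.
Proof.
move=> fpP A B C i q [_ iq q_surj] /pure_equationally_pure pui.
apply: finitely_presented_pure_lift => //.
suff -> : [set x | q x = 0] = range i by [].
apply/seteqP; split=> [x /iq[y <-]|_ [y _ <-]]; first by exists y.
by apply/iq; exists y.
Qed.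

End FlatModules.

(** * Direct sums *)

Section DependentProduct.
Variables (R : pzRingType) (I : Type) (K : I -> lmodType R).

Definition dprod : Type := forall i, K i.

HB.instance Definition _ := Choice.copy dprod (forall i, K i).

Implicit Types x y z : dprod.

Definition dprod_add x y : dprod := fun i => x i + y i.
Definition dprod_opp x : dprod := fun i => - x i.
Definition dprod_scale (r : R) x : dprod := fun i => r *: x i.

Lemma dprodP x y : (forall i, x i = y i) -> x = y.
Proof. exact: functional_extensionality_dep. Qed.

Fact dprod_addA : associative dprod_add.
Proof. by move=> x y z; apply: dprodP => i; exact: addrA. Qed.

Fact dprod_addC : commutative dprod_add.
Proof. by move=> x y; apply: dprodP => i; exact: addrC. Qed.

Fact dprod_add0 : left_id (fun i => 0) dprod_add.
Proof. by move=> x; apply: dprodP => i; exact: add0r. Qed.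

Fact dprod_addN : left_inverse (fun i => 0) dprod_opp dprod_add.
Proof. by move=> x; apply: dprodP => i; exact: addNr. Qed.

HB.instance Definition _ := GRing.isZmodule.Build dprod
  dprod_addA dprod_addC dprod_add0 dprod_addN.

Fact dprod_scaleA a b x :
  dprod_scale a (dprod_scale b x) = dprod_scale (a * b) x.
Proof. by apply: dprodP => i; exact: scalerA. Qed.

Fact dprod_scale1 : left_id 1 dprod_scale.
Proof. by move=> x; apply: dprodP => i; exact: scale1r. Qed.

Fact dprod_scaleDr : right_distributive dprod_scale +%R.
Proof. by move=> a x y; apply: dprodP => i; exact: scalerDr. Qed.

Fact dprod_scaleDl x : {morph dprod_scale^~ x : a b / a + b}.
Proof. by move=> a b; apply: dprodP => i; exact: scalerDl. Qed.

HB.instance Definition _ := GRing.Zmodule_isLmodule.Build R dprod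
  dprod_scaleA dprod_scale1 dprod_scaleDr dprod_scaleDl.

End DependentProduct.

Section DirectSum.
Variables (R : pzRingType) (I : choiceType) (K : I -> lmodType R).

Fact is_submod_finite_support : is_submod
  [set x : dprod K | exists A : {fset I}, forall i, i \notin A -> x i = 0].
Proof.
split=> [|r x y [A xA] [B yB]]; first by exists fset0.
exists (A `|` B)%fset => i; rewrite in_fsetU negb_or => /andP[/xA xi /yB yi].
by rewrite -[LHS]/(r *: x i + y i) xi yi scaler0 addr0.
Qed.

Definition dsum : lmodType R := submod (submod_of is_submod_finite_support).

Fact dsum_proj_linear i : linear (fun x : dsum => submod_val x i).
Proof. by []. Qed.

Definition dsum_proj i : {linear dsum -> K i} :=
  linear_of (@dsum_proj_linear i).

Lemma dsumP (x y : dsum) : (forall i, dsum_proj i x = dsum_proj i y) -> x = y.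
Proof. by move=> xy; apply: val_inj; exact: dprodP. Qed.

Lemma dsum_supportP (x : dsum) :
  exists A : {fset I}, forall i, i \notin A -> dsum_proj i x = 0.
Proof. by case: x => x xA; have /submod_ofP := xA. Qed.

Lemma dsum_common_support (s : seq dsum) : exists A : {fset I},
  forall x, x \in s -> forall i, i \notin A -> dsum_proj i x = 0.
Proof.
elim: s => [|x s [A sA]]; first by exists fset0.
have [B xB] := dsum_supportP x; exists (A `|` B)%fset => y.
rewrite inE => /predU1P[->|ys] i; rewrite in_fsetU negb_or => /andP[iA iB].
  exact: xB.
exact: sA.
Qed.

Fact dsum_incl_subproof i (v : K i) :
  (dfwith (fun j => 0 : K j) v : dprod K)
    \in submod_of is_submod_finite_support.
Proof.
apply/submod_ofP; exists [fset i]%fset => j; rewrite in_fset1 eq_sym.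
exact: dfwith_out.
Qed.

Fact dsum_incl_linear i : linear (fun v : K i => Submod (dsum_incl_subproof v)).
Proof.
move=> r v w; apply: val_inj; apply: dprodP => j.
rewrite -[RHS]/(r *: dfwith _ v j + dfwith _ w j) /=.
have [ij|ij] := eqVneq i j; first by case: _ / ij; rewrite !dfwith_in.
by rewrite !dfwith_out // scaler0 addr0.
Qed.

Definition dsum_incl i : {linear K i -> dsum} :=
  linear_of (@dsum_incl_linear i).

Lemma dsum_inclK i : cancel (dsum_incl i) (dsum_proj i).
Proof. by move=> v; exact: dfwith_in. Qed.

Lemma dsum_proj_incl i j v : i != j -> dsum_proj i (dsum_incl j v) = 0.
Proof. by rewrite eq_sym; exact: dfwith_out. Qed.

Lemma dsum_decomp (x : dsum) (A : {fset I}) :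
  (forall i, i \notin A -> dsum_proj i x = 0) ->
  x = \sum_(i <- A) dsum_incl i (dsum_proj i x).
Proof.
move=> xA; apply: dsumP => j; rewrite linear_sum.
have [jA|jA] := boolP (j \in A); last first.
  rewrite xA // big_seq big1 // => i iA; apply: dsum_proj_incl.
  by apply: contraNneq jA => ->.
rewrite (bigD1_seq j) ?fset_uniq // big1 => [|i ij].
  by rewrite [RHS]addr0; exact/esym/dsum_inclK.
by apply: dsum_proj_incl; rewrite eq_sym.
Qed.

Lemma dsum_additive_ext (G : zmodType) (f g : {additive dsum -> G}) :
  (forall i v, f (dsum_incl i v) = g (dsum_incl i v)) -> f =1 g.
Proof.
move=> fg x; have [A xA] := dsum_supportP x.
by rewrite (dsum_decomp xA) !raddf_sum; apply: eq_bigr => i _.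
Qed.

Section AdditiveLift.
Variables (G : zmodType) (g : forall i, {additive K i -> G}).

Definition dsum_lift (x : dsum) : G :=
  \sum_(i \in [set: I]) g i (dsum_proj i x).

Lemma dsum_liftE (x : dsum) (A : {fset I}) :
  (forall i, i \notin A -> dsum_proj i x = 0) ->
  dsum_lift x = \sum_(i <- A) g i (dsum_proj i x).
Proof. by move=> xA; apply: fsbigTE => i /xA ->; rewrite raddf0. Qed.

Fact dsum_lift_additive : zmod_morphism dsum_lift.
Proof.
move=> x y; have [A xyA] := dsum_common_support [:: x; y].
have xA : forall i, i \notin A -> dsum_proj i x = 0.
  by apply: xyA; exact: mem_head.
have yA : forall i, i \notin A -> dsum_proj i y = 0.
  by apply: xyA; rewrite !inE eqxx orbT.
rewrite (dsum_liftE xA) (dsum_liftE yA) -sumrB (@dsum_liftE _ A) => [|i iA].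
  by apply: eq_bigr => i _; rewrite !raddfB.
by rewrite linearB xA ?yA ?subrr.
Qed.

HB.instance Definition _ :=
  GRing.isZmodMorphism.Build dsum G dsum_lift dsum_lift_additive.

Lemma dsum_lift_incl i v : dsum_lift (dsum_incl i v) = g i v.
Proof.
rewrite (@dsum_liftE _ [fset i]%fset) => [|j].
  by rewrite big_seq_fset1 [dsum_proj i _]dsum_inclK.
by rewrite in_fset1; exact: dsum_proj_incl.
Qed.

End AdditiveLift.

Lemma dsum_lift_linear (N : lmodType R) (g : forall i, {linear K i -> N}) :
  linear (dsum_lift g).
Proof.
move=> r x y; rewrite raddfD; congr (_ + _).
apply: (dsum_additive_ext (f := dsum_lift g \o *:%R r)
  (g := *:%R r \o dsum_lift g)) => i v.
rewrite -[LHS]/(dsum_lift g (r *: dsum_incl i v)) -linearZ dsum_lift_incl.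
rewrite -[RHS]/(r *: dsum_lift g (dsum_incl i v)) dsum_lift_incl.
exact: linearZ.
Qed.

Lemma dsum_flat : (forall i, flat (K i)) -> flat dsum.
Proof.
move=> flK; apply/flatP => m l S e Se0.
have [A eA] := dsum_common_support [seq e k | k <- enum 'I_l].
have {eA} eE : e =
    \sum_(i <- A) (dsum_incl i \o (dsum_proj i \o e) : 'I_l -> dsum).
  apply/funext => k; rewrite fct_sumE; apply: dsum_decomp.
  by apply: eA; rewrite map_f ?mem_enum.
rewrite eE; apply/(subgroup_ofP (is_subgroup_row_span _ _))/rpred_sum => i _.
have /flatP flKi := flK i.
by apply/subgroup_ofP/trivial_relation_linear/flKi/mxact_linear_eq0.
Qed.

End DirectSum.

Arguments dsum_proj {R I K} i.
Arguments dsum_incl {R I K} i.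

(** * Free modules *)

Section FreeModule.
Variables (R : pzRingType) (J : choiceType).

Definition free_module : lmodType R := dsum (fun _ : J => R^o).

Definition free_basis (j : J) : free_module := dsum_incl j (1 : R^o).

Lemma dsum_incl_free j (r : R^o) : dsum_incl j r = (r : R) *: free_basis j.
Proof. by rewrite -linearZ; congr (dsum_incl _ _); exact/esym/mulr1. Qed.

Fact free_coord_linear (N : lmodType R) (b : J -> N) j :
  linear (fun r : R^o => (r : R) *: b j).
Proof. by move=> r s t; rewrite -[r *: s + t]/(r * s + t) scalerDl scalerA. Qed.

Definition free_lift (N : lmodType R) (b : J -> N) :
    {linear free_module -> N} :=
  linear_of (dsum_lift_linear (fun j => linear_of (free_coord_linear b j))).

Lemma free_lift_basis (N : lmodType R) (b : J -> N) j :
  free_lift b (free_basis j) = b j.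
Proof. by rewrite [LHS]dsum_lift_incl -[RHS]scale1r. Qed.

Lemma free_linear_ext (N : lmodType R) (f g : {linear free_module -> N}) :
  (forall j, f (free_basis j) = g (free_basis j)) -> f =1 g.
Proof.
move=> fg; apply: dsum_additive_ext => j r.
by rewrite dsum_incl_free [LHS]linearZ [RHS]linearZ fg.
Qed.

Lemma free_projective : projective_module free_module.
Proof.
move=> B C p /choice[s sK] f.
exists (free_lift (fun j => s (f (free_basis j)))).
apply: (free_linear_ext (f := p \o free_lift _)) => j.
by rewrite -[LHS]/(p (free_lift _ (free_basis j))) free_lift_basis.
Qed.

Lemma range_free_lift (N : lmodType R) (b : J -> N) :
  is_submod (range b) -> range (free_lift b) = range b.
Proof.
move=> bsub; apply/seteqP; split=> [_ [x _ <-]|_ [j _ <-]]; last first.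
  by exists (free_basis j); rewrite ?free_lift_basis.
have [A xA] := dsum_supportP x; rewrite (dsum_decomp xA) linear_sum.
elim/big_rec: _ => [|j y _ yb]; first exact: bsub.1.
rewrite dsum_incl_free linearZ free_lift_basis.
by apply: bsub.2 => //; exists j.
Qed.

Lemma free_lift_surj (N : lmodType R) (b : J -> N) :
  surjective_map b -> surjective_map (free_lift b).
Proof.
by move=> b_surj x; have [j <-] := b_surj x; exists (free_basis j);
  exact: free_lift_basis.
Qed.

End FreeModule.

Section FreeRightModule.
Variables (R : pzRingType) (J : choiceType).
Let X : lmodType R^c := free_module R^c J.

Fact free_tensor_coord_balanced (B : lmodType R) j :
  balanced (fun (x : X) (b : B) => (dsum_proj j x : R) *: b).
Proof.
split=> [x y b|x b b'|r x b].
- by rewrite linearD -scalerDl.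
- by rewrite scalerDr.
- by rewrite linearZ scalerA.
Qed.

Definition free_tensor_coord (B : lmodType R) j : {additive tensor X B -> B} :=
  tensor_lift (free_tensor_coord_balanced B j).

Lemma free_tensor_coordP (B : lmodType R) (u : tensor X B) :
  (forall j, free_tensor_coord B j u = 0) -> u = 0.
Proof.
rewrite -[u]reprK tensor_sumE; move: (repr u) => s {u} s0.
have [A sA] := dsum_common_support (map fst s).
transitivity (\sum_(p <- s) \sum_(j <- A)
    pure_tensor (free_basis R^c j) ((dsum_proj j p.1 : R) *: p.2)).
  apply: eq_big_seq => p ps; rewrite {1}(dsum_decomp (sA p.1 _)) ?map_f //.
  rewrite pure_tensor_suml.
  by under eq_bigr do rewrite dsum_incl_free pure_tensorZ.
have coord0 j : \sum_(p <- s) (dsum_proj j p.1 : R) *: p.2 = 0.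
  rewrite -[RHS](s0 j) raddf_sum; apply: eq_bigr => p _.
  by rewrite tensor_liftE.
rewrite exchange_big big1 // => j _.
by rewrite -pure_tensor_sumr coord0 pure_tensor0r.
Qed.

Lemma free_flat_right : flat_right X.
Proof.
move=> A B i i_inj.
suff ker0 u : tensor_map (idfun : {linear X -> X}) i u = 0 -> u = 0.
  exact: raddf_inj.
move=> iu0; apply: free_tensor_coordP => j; apply: i_inj.
have coord_i : i \o free_tensor_coord A j =1
    free_tensor_coord B j \o tensor_map (idfun : {linear X -> X}) i.
  apply: tensor_additive_ext => x a.
  by rewrite /= tensor_map_pure !tensor_liftE linearZ.
by rewrite [LHS]coord_i /= iu0 !raddf0.
Qed.

End FreeRightModule.

(** * Chains of sets and Zorn's lemma *)

Lemma Zorn_above (T : Type) (P : set (set T)) (A0 : set T) : P A0 ->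
  (forall F : set (set T), F !=set0 -> total_on F subset ->
    (forall A, F A -> A0 `<=` A /\ P A) -> P (\bigcup_(X in F) X)) ->
  exists A, [/\ A0 `<=` A, P A & forall B, A `<=` B -> P B -> B `<=` A].
Proof.
move=> PA0 Pcup.
have [F FP Ftot|A [PA Amax]] := @Zorn_bigcup T [set A | P (A0 `|` A)].
  have [[X FX]|/set0P/negP] := pselect (F !=set0); last first.
    by rewrite negbK => /eqP ->; rewrite /= bigcup_set0 setU0.
  rewrite /= -bigcupUr; last by exists X.
  rewrite -(bigcup_image F (setU A0) id); apply: Pcup.
  - by exists (A0 `|` X), X.
  - move=> _ _ [Y FY <-] [Z FZ <-].
    by have [YZ|ZY] := Ftot _ _ FY FZ; [left|right]; exact: setUS.
  - by move=> _ [Y FY <-]; split; [exact: subsetUl | exact: FP].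
exists (A0 `|` A); split=> // B AB PB.
move: (AB); rewrite subUset => -[A0B AB'].
have BA : B `<=` A; last exact: subset_trans BA (@subsetUr _ _ _).
apply: contrapT => nBA; apply: (Amax B); first by split.
by rewrite /= (setUidr A0B).
Qed.

Lemma bigcup_total_fin (T : Type) (F : set (set T)) n (a : 'I_n -> T) :
  F !=set0 -> total_on F subset -> (forall j, (\bigcup_(X in F) X) (a j)) ->
  exists2 X, F X & forall j, X (a j).
Proof.
move=> [X0 FX0] Ftot; elim: n a => [|n IHn] a aF; first by exists X0 => // -[].
have [X FX Xa] := IHn (fun j => a (lift ord0 j)) (fun j => aF _).
have [Y FY Ya] := aF ord0.
have [XY|YX] := Ftot _ _ FX FY.
  by exists Y => // j; case: (unliftP ord0 j) => [i|] -> //; exact: XY.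
by exists X => // j; case: (unliftP ord0 j) => [i|] -> //; exact: YX.
Qed.

Lemma bigcup_total2 (T : Type) (F : set (set T)) x y :
  F !=set0 -> total_on F subset ->
  (\bigcup_(X in F) X) x -> (\bigcup_(X in F) X) y ->
  exists X, [/\ F X, X x & X y].
Proof.
move=> F0 Ftot xF yF.
have [j|X FX Xxy] := bigcup_total_fin (a := tnth [tuple x; y]) F0 Ftot.
  by case: j => [[|[|//]] ?].
by exists X; split=> //; [exact: (Xxy ord0) | exact: (Xxy ord_max)].
Qed.

(** * Divisible groups are injective *)

Lemma int_subgroup_cyclic (I : set int) : is_subgroup I ->
  exists d : nat, forall n, I n <-> (d %| n)%Z.
Proof.
move=> Isub; have [I0 IB] := Isub.
have Iabs n : I n -> I `|n|%N.
  case: n => n In //; rewrite /= -[Posz _]opprK -NegzE -[- _]add0r.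
  exact: IB.
have IM d n : I d -> (d %| n)%Z -> I n.
  by move=> Id /dvdzP[q ->]; rewrite mulrC -mulrzz; exact: is_subgroup_mulrz.
have [exd|nod] := pselect (exists d : nat, (0 < d)%N && `[< I d >]); last first.
  exists 0%N => n; rewrite dvd0z; split=> [In|/eqP -> //].
  apply: contra_notT nod => n0; exists `|n|%N; rewrite absz_gt0 n0.
  exact/asboolP/Iabs.
have [d /andP[d_gt0 /asboolP Id] d_min] := ex_minnP exd.
exists d => n; split=> [In|]; last exact: IM.
have Ir : I (n %% d)%Z.
  rewrite [X in I X](_ : _ = n - (n %/ d)%Z * d); last by
    rewrite {2}(divz_eq n d) addrC addKr.
  by apply: IB => //; apply: IM Id _; exact: dvdz_mull.
apply/dvdz_mod0P/eqP; apply: contraT => r0.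
have : (d <= `|(n %% d)%Z|)%N.
  by apply: d_min; rewrite absz_gt0 r0; exact/asboolP/Iabs.
by rewrite -lez_nat gez0_abs ?modz_ge0 -?lt0n // leNgt ltz_pmod.
Qed.

Definition divisible (D : zmodType) : Prop :=
  forall (q : D) d, (0 < d)%N -> exists q', q' *+ d = q.

Section AdditiveGraphs.
Variables (B D : zmodType).
Implicit Type G : set (B * D).

Definition additive_graph G : Prop :=
  is_subgroup G /\ forall z, G (0, z) -> z = 0.

Lemma additive_graph_fun G b z z' :
  additive_graph G -> G (b, z) -> G (b, z') -> z = z'.
Proof.
move=> [[_ GB] G0] Gz Gz'; apply/eqP; rewrite -subr_eq0; apply/eqP/G0.
by rewrite -(subrr b); exact: (GB _ _ Gz Gz').
Qed.

Lemma additive_graph_bigcup (F : set (set (B * D))) :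
  F !=set0 -> total_on F subset -> (forall G, F G -> additive_graph G) ->
  additive_graph (\bigcup_(G in F) G).
Proof.
move=> F0 Ftot Fg; split=> [|z [G FG]]; last by have [_] := Fg _ FG; apply.
split=> [|p q pF qF].
  by have [G FG] := F0; exists G => //; case: (Fg _ FG) => -[].
have [G [FG Gp Gq]] := bigcup_total2 F0 Ftot pF qF.
by exists G => //; have [[_ GB] _] := Fg _ FG; exact: GB.
Qed.

Lemma pair_mulrz (b : B) (q : D) (n : int) : (b, q) *~ n = (b *~ n, q *~ n).
Proof.
by apply: injective_projections; [exact: (raddfMz fst)|exact: (raddfMz snd)].
Qed.

(* The integers [n] with [b *~ n] in the domain of [G] are the multiples of
   some [d], and [q] has to be a [d]-th part of the value at [b *~ d]. *)
Lemma additive_graph_value G (b : B) : divisible D -> additive_graph G ->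
  exists q : D, forall (n : int) z, G (b *~ n, z) -> z = q *~ n.
Proof.
move=> divD [Gsub G0]; have [G00 GB] := Gsub.
have [|d dP] := @int_subgroup_cyclic [set n | exists z, G (b *~ n, z)].
  split=> [|m n [z Gz] [z' Gz']]; first by exists 0.
  by exists (z - z'); rewrite mulrzBr; exact: (GB _ _ Gz Gz').
have [z0 Gd] : exists z, G (b *~ d, z) by apply/dP.
have [q qd] : exists q : D, q *+ d = z0.
  case: d Gd {dP} => [|d] Gd; last exact: divD.
  by exists 0; rewrite (G0 z0).
exists q => n z Gn; have /dvdzP[k nE] : (d %| n)%Z by apply/dP; exists z.
apply: (additive_graph_fun (conj Gsub G0) Gn).
have := is_subgroup_mulrz Gsub k Gd.
by rewrite pair_mulrz nE [k * _]mulrC !mulrzA -qd.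
Qed.

Lemma additive_graph_adjoin G (b : B) : divisible D -> additive_graph G ->
  exists G' : set (B * D),
    [/\ additive_graph G', G `<=` G' & exists q, G' (b, q)].
Proof.
move=> divD Gg; have [q qP] := additive_graph_value b divD Gg.
have [Gsub G0] := Gg; have [G00 GB] := Gsub.
exists [set p | exists n : int, G (p - (b, q) *~ n)]; split; first split.
- split=> [|p p' [n Gp] [n' Gp']]; first by exists 0; rewrite mulr0z subr0.
  by exists (n - n'); rewrite mulrzBr opprD addrACA -opprD; exact: GB.
- move=> z [n]; rewrite pair_mulrz => Gn.
  have : G (b *~ (- n), z - q *~ n) by rewrite mulrNz -[- (b *~ n)]add0r.
  by move=> /qP; rewrite mulrNz -[RHS]add0r => /addIr.
- by move=> p Gp; exists 0; rewrite mulr0z subr0.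
- by exists q, 1; rewrite mulr1z subrr.
Qed.

Lemma additive_graph_extend G : divisible D -> additive_graph G ->
  exists f : {additive B -> D}, forall b z, G (b, z) -> f b = z.
Proof.
move=> divD Gg.
have [F F0 Ftot Fg|H [GH Hg Hmax]] := Zorn_above Gg.
  by apply: additive_graph_bigcup => // A /Fg[].
have /choice[f fH] b : exists z, H (b, z).
  have [H' [H'g HH' [q H'bq]]] := additive_graph_adjoin b divD Hg.
  by exists q; exact: Hmax H' HH' H'g _ H'bq.
have [[_ HB] _] := Hg.
have f_add : zmod_morphism f.
  move=> x y; apply: additive_graph_fun Hg (fH _) _.
  exact: (HB _ _ (fH x) (fH y)).
by exists (additive_of f_add) => b z /GH; exact: additive_graph_fun Hg (fH b).
Qed.

End AdditiveGraphs.

Lemma divisible_injective (A B D : zmodType) (i : {additive A -> B}) :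
  divisible D -> injective i -> forall f : {additive A -> D},
  exists h : {additive B -> D}, h \o i =1 f.
Proof.
move=> divD i_inj f.
have [|h hE] := @additive_graph_extend B D (range (fun x => (i x, f x))) divD.
  split=> [|z [x _ [ix0 <-]]].
    split=> [|_ _ [x _ <-] [y _ <-]]; first by exists 0; rewrite ?raddf0.
    by exists (x - y); rewrite ?raddfB.
  by rewrite (_ : x = 0) ?raddf0 //; apply: i_inj; rewrite raddf0.
by exists h => x; apply: hE; exists x.
Qed.

Lemma QmodZ_divisible : divisible QmodZ.
Proof.
move=> q d d_gt0; exists (\pi_QmodZ (repr q / d%:R)).
rewrite -raddfMn -(mulr_natr (repr q / _)) mulfVK; first exact: reprK.
by rewrite pnatr_eq0 -lt0n.
Qed.

Lemma QmodZ_pi_eq0 (x : rat) : (\pi_QmodZ x == 0) = (x \is a Num.int).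
Proof.
by rewrite -[RHS]/(x \in rat_int) -[x in RHS]subr0 Quotient.idealrBE
  -(raddf0 \pi_QmodZ).
Qed.

Lemma QmodZ_torsion d : (1 < d)%N -> exists2 q : QmodZ, q != 0 & q *+ d = 0.
Proof.
move=> d_gt1; have d0 : d%:R != 0 :> rat by rewrite pnatr_eq0; case: d d_gt1.
exists (\pi_QmodZ d%:R^-1).
  rewrite QmodZ_pi_eq0; apply/negP => /intrP[k kE].
  have : (k * d%:Z)%:~R = 1%:~R :> rat by rewrite intrM -kE /= mulVf.
  move/eqP; rewrite eqr_int => /eqP/(congr1 absz); rewrite abszM /=.
  by move/eqP; rewrite muln_eq1 => /andP[_ /eqP d1]; rewrite d1 in d_gt1.
by apply/eqP; rewrite -raddfMn QmodZ_pi_eq0 -(mulr_natr d%:R^-1) mulVf.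
Qed.

Lemma QmodZ_separates (M : zmodType) (x : M) : x != 0 ->
  exists f : {additive M -> QmodZ}, f x != 0.
Proof.
move=> x0; have [|d dP] := @int_subgroup_cyclic [set n | x *~ n = 0].
  by split=> [|m n /= xm xn]; rewrite /= ?mulr0z ?mulrzBr ?xm ?xn ?subrr.
have d_neq1 : d != 1%N.
  by apply: contraNneq x0 => d1; rewrite -[x]mulr1z; apply/eqP/dP; rewrite d1.
have [q q0 qd] : exists2 q : QmodZ, q != 0 & q *+ d = 0.
  have [->|d_neq0] := eqVneq d 0%N.
    by have [q q0 _] := @QmodZ_torsion 2 isT; exists q.
  by apply: QmodZ_torsion; case: d d_neq0 d_neq1 {dP} => [|[]].
have qP (n : int) : x *~ n = 0 -> q *~ n = 0.
  by move=> /dP/dvdzP[k ->]; rewrite mulrC mulrzA -pmulrn qd mul0rz.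
pose G := range (fun n : int => (x *~ n, q *~ n)).
have [|h hE] := additive_graph_extend (G := G) QmodZ_divisible.
  split=> [|z [n _ [/qP qn0 <-]] //].
  split=> [|_ _ [m _ <-] [n _ <-]]; first by exists 0; rewrite ?mulr0z.
  by exists (m - n); rewrite ?mulrzBr.
by exists h; rewrite (hE x q) //; exists 1; rewrite ?mulr1z.
Qed.

(** * Character modules *)

Section CharacterModules.
Variable R : pzRingType.

Fact char_of_additive_subproof (F : lmodType R^c) (f : {additive F -> QmodZ}) :
  (f : F -> QmodZ) \in @char_pred R F.
Proof. by apply/asboolP => x y; exact: raddfD. Qed.

Definition char_of_additive (F : lmodType R^c) (f : {additive F -> QmodZ}) :
    char_module F :=
  CharModule (char_of_additive_subproof f).

Lemma char_valD (F : lmodType R^c) (phi : char_module F) x y :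
  phi (x + y) = phi x + phi y.
Proof. by case: phi => f /= /asboolP; apply. Qed.

Lemma flat_right_char_injective (F : lmodType R^c) :
  flat_right F -> injective_module (char_module F).
Proof.
move=> flF A B i i_inj f.
have f_bal : balanced (fun x a => f a x).
  split=> [x y a|x a a'|r x a]; first exact: char_valD.
  - by rewrite linearD.
  - by rewrite linearZ.
have [psi psiE] :=
  divisible_injective QmodZ_divisible (flF _ _ _ i_inj) (tensor_lift f_bal).
have psi_add b : zmod_morphism (fun x => psi (pure_tensor x b)).
  by move=> x y; rewrite -raddfB; congr (psi _); rewrite pure_tensorBl.
have h_lin : linear (fun b => char_of_additive (additive_of (psi_add b))).
  move=> r b b'; apply: char_moduleP => x /=.
  by rewrite pure_tensorDr raddfD -pure_tensorZ.
exists (linear_of h_lin) => a; apply: char_moduleP => x.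
by rewrite -(tensor_liftE f_bal) -psiE /= tensor_map_pure.
Qed.

Section EvaluationCharacters.
Variable M : lmodType R.

Let characters : choiceType := {classic {additive M -> QmodZ}}.

Definition free_char_module : lmodType R :=
  char_module (free_module R^c characters).

Fact scaled_character_additive (x : M) (chi : {additive M -> QmodZ}) :
  zmod_morphism (fun r : (R^c)^o => chi ((r : R) *: x)).
Proof. by move=> r s; rewrite scalerBl raddfB. Qed.

Definition evaluation_char (x : M) : free_char_module :=
  char_of_additive (dsum_lift (fun chi : characters =>
    additive_of (scaled_character_additive x chi))).

Lemma evaluation_charE x (chi : characters) (r : (R^c)^o) :
  evaluation_char x (dsum_incl chi r) =
  (chi : {additive M -> QmodZ}) ((r : R) *: x).
Proof. exact: dsum_lift_incl. Qed.

Lemma free_char_module_ext (phi psi : free_char_module) :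
  (forall chi r, phi (dsum_incl chi r) = psi (dsum_incl chi r)) -> phi = psi.
Proof.
move=> eq_incl; apply: char_moduleP.
have val_add (theta : free_char_module) : zmod_morphism theta.
  move=> x y; apply: (addIr (theta y)).
  by rewrite -[LHS]char_valD !subrK.
exact: (dsum_additive_ext (f := additive_of (val_add phi))
  (g := additive_of (val_add psi))).
Qed.

Lemma evaluation_char_linear : linear evaluation_char.
Proof.
move=> r x y; apply: free_char_module_ext => chi s.
rewrite evaluation_charE scalerDr raddfD scalerA.
rewrite -[RHS]/(evaluation_char x ((r : R^c) *: dsum_incl chi s) +
  evaluation_char y (dsum_incl chi s)).
by rewrite -linearZ !evaluation_charE.
Qed.

Lemma evaluation_char_inj : injective (linear_of evaluation_char_linear).
Proof.
suff ker0 x : linear_of evaluation_char_linear x = 0 -> x = 0.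
  exact: raddf_inj.
apply: contraPP => /eqP/QmodZ_separates[chi chix] ex0; case/eqP: chix.
rewrite -[x in LHS]scale1r -(evaluation_charE x chi (1 : R)).
by rewrite [evaluation_char x]ex0.
Qed.

End EvaluationCharacters.

Lemma embeds_in_char_module (M : lmodType R) :
  exists F : lmodType R^c, flat_right F /\
    exists i : {linear M -> char_module F}, injective i.
Proof.
exists (free_module R^c {classic {additive M -> QmodZ}}).
split; first exact: free_flat_right.
by exists (linear_of (@evaluation_char_linear M)); exact: evaluation_char_inj.
Qed.

End CharacterModules.

(** * FP-injective modules *)

Section FPInjective.
Variable R : pzRingType.
Implicit Types E M N : lmodType R.

Lemma injective_FP_injective N : injective_module N -> FP_injective N.
Proof.
move=> injN F _ P2 P1 P0 d2 d1 e _ _ _ d21 _ _ f fd2.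
have [d' d'E d'_surj] := lin_range_factor d1.
have [x d'x0|g gE] := linear_factor (q := f) d'_surj.
  have /d21[y <-] : d1 x = 0 by rewrite -d'E -[LHS]/(submod_incl _ (d' x)) d'x0.
  exact: fd2.
have [h hE] := injN _ _ _ (@submod_incl_inj R _ (lin_range d1)) g.
by exists h => x; rewrite /= -d'E [LHS]hE [LHS]gE.
Qed.

Lemma submod_range_projective M (N : submodClosed M) :
  exists (P : lmodType R) (p : {linear P -> M}),
    projective_module P /\ range p = [set` N].
Proof.
pose e (y : {classic submod N}) : submod N := y.
exists (free_module R {classic submod N}),
  (submod_incl N \o free_lift e : {linear _ -> _}).
split; first exact: free_projective.
apply/seteqP; split=> [_ [x _ <-]|y yN]; first exact: valP.
have [|x xE] := free_lift_surj (b := e) _ (Submod yN).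
  by move=> z; exists z.
by exists x => //; rewrite -[LHS]/(submod_incl N (free_lift e x)) xE.
Qed.

Lemma FP_injective_equationally_pure E (N : submodClosed E) :
  FP_injective (submod N) -> equationally_pure [set` N].
Proof.
move=> fpN m l S b SbN.
pose d := mulmxr S : {linear 'rV[R]_m -> 'rV[R]_l}.
have [P2 [d2 [projP2 d2E]]] := submod_range_projective (lin_ker d).
have d2_exact : exact_at d2 d.
  move=> w; split=> [dw0|[x <-]].
    have : range d2 w by rewrite d2E; exact/submod_ofP.
    by move=> [x _ <-]; exists x.
  by have : range d2 (d2 x) by []; rewrite d2E => /submod_ofP.
pose f := lincomb (fun j => Submod (SbN j) : submod N).
have fE w : submod_incl N (f w) = lincomb b (d w).
  by rewrite linear_lincomb -[d w]/(w *m S) lincomb_mulmx.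
have fd2 x : f (d2 x) = 0.
  have /d2_exact dd2 : exists y, d2 y = d2 x by exists x.
  by apply: submod_incl_inj; rewrite fE dd2 !linear0.
have [h hE] := fpN _ (finitely_presented_cokermod S) _ _ _
  d2 d (cokermod_proj S) projP2 (@row_projective R m) (@row_projective R l)
  d2_exact (cokermod_exact S) (@cokermod_proj_surj _ _ _ S) f fd2.
exists (fun k => submod_incl N (h 'e_k)) => [k|]; first exact: valP.
apply/funext => j; rewrite -[LHS]lincomb_delta -lincomb_mulmx -linear_lincomb.
rewrite -linear_rowE [h _]hE fE -[d _]/('e_j *m S) lincomb_mulmx.
exact: lincomb_delta.
Qed.

End FPInjective.

(** * Flat precovers *)

Section PureSubmodules.
Variable R : pzRingType.
Implicit Types L M N : lmodType R.

Definition pure_submod M (P : set M) : Prop :=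
  is_submod P /\ equationally_pure P.

Lemma pure_submod0 M : pure_submod ([set 0] : set M).
Proof.
split=> [|m l S b Sb0]; first by split=> // r x y -> ->; rewrite scaler0 addr0.
by exists 0 => //; rewrite raddf0; apply/funext => j; rewrite Sb0.
Qed.

Lemma pure_submod_bigcup M (F : set (set M)) :
  F !=set0 -> total_on F subset -> (forall P, F P -> pure_submod P) ->
  pure_submod (\bigcup_(P in F) P).
Proof.
move=> F0 Ftot Fpure; split=> [|m l S b SbF]; first split.
- by have [P FP] := F0; exists P => //; case: (Fpure _ FP) => -[].
- move=> r x y xF yF; have [P [FP Px Py]] := bigcup_total2 F0 Ftot xF yF.
  by exists P => //; have [[_ PD] _] := Fpure _ FP; exact: PD.
- have [P FP Sb] := bigcup_total_fin F0 Ftot SbF.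
  have [a Pa Sa] := (Fpure _ FP).2 _ _ S b Sb.
  by exists a => // k; exists P.
Qed.

Lemma pure_submod_preimage M N (p : {linear M -> N}) (P : set N) :
  surjective_map p -> equationally_pure [set x | p x = 0] -> pure_submod P ->
  pure_submod (p @^-1` P).
Proof.
move=> /choice[s sK] pup [Psub Ppure]; split; first exact: is_submod_preimage.
move=> m l S b SbP.
have [j|c Pc Sc] := Ppure _ _ S (p \o b).
  by rewrite -linear_mxact; exact: SbP.
pose u : 'I_l -> M := s \o c.
have pbu : p \o (b - u) = p \o b - c.
  by apply/funext => k; rewrite /= linearB [p (u k)]sK.
have [j|a pa0 Sa] := pup _ _ S (b - u).
  by rewrite /= linear_mxactE pbu mxactB Sc subrr.
exists (u + a) => [k|]; first by rewrite /= linearD pa0 addr0 sK.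
by rewrite raddfD /= Sa mxactB addrC subrK.
Qed.

Lemma pure_submod_range_lift M N L (p : {linear M -> N}) (d : {linear L -> M}) :
  equationally_pure (range (p \o d)) -> (forall x, p (d x) = 0 -> d x = 0) ->
  pure_submod (range d).
Proof.
move=> pd_pure pd_inj; split=> [|m l S b Sbd]; first exact: is_submod_range.
have [j|c cd Sc] := pd_pure _ _ S (p \o b).
  by rewrite -linear_mxact; have [x _ xE] := Sbd j; exists x; rewrite //= xE.
have /choice[w wE] k : exists x, p (d x) = c k by have [x _] := cd k; exists x.
exists (d \o w) => [k|]; first by exists (w k).
have pdw : p \o (d \o w) = c by apply/funext => k; exact: wE.
apply/funext => j; have [x _ xE] := Sbd j.
rewrite -xE -linear_mxactE; apply/eqP; rewrite -subr_eq0 -linearB; apply/eqP.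
apply: pd_inj; rewrite !linearB xE (linear_mxactE d) !(linear_mxactE p) pdw Sc.
exact: subrr.
Qed.

Lemma max_pure_submod M (K : set M) : K 0 ->
  exists P, [/\ pure_submod P, P `<=` K &
    forall Q, pure_submod Q -> Q `<=` K -> P `<=` Q -> Q `<=` P].
Proof.
move=> K0; pose pure_in_K := [set P | pure_submod P /\ P `<=` K].
have [||P [_ [Ppure PK] Pmax]] := @Zorn_above M pure_in_K [set 0].
- by split=> [|_ -> //]; exact: pure_submod0.
- move=> F F0 Ftot FK; split=> [|x [P /FK[_ [_ PK]]]]; last exact: PK.
  by apply: pure_submod_bigcup => // P /FK[_ []].
by exists P; split=> // Q Qpure QK PQ; exact: (Pmax Q).
Qed.

Definition pure_kernel_free M N (f : {linear M -> N}) : Prop :=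
  forall P, pure_submod P -> P `<=` [set x | f x = 0] -> P `<=` [set 0].

Lemma factor_pure_kernel_free M N (f : {linear M -> N}) :
  exists M' (p : {linear M -> M'}) (f' : {linear M' -> N}),
    [/\ surjective_map p, equationally_pure [set x | p x = 0],
        f' \o p =1 f & pure_kernel_free f'].
Proof.
have [P [[Psub Ppure] Pf Pmax]] :=
  max_pure_submod (K := [set x | f x = 0]) (linear0 f).
pose p := quotmod_proj (submod_of Psub).
have p_surj : surjective_map p by exact: quotmod_proj_surj.
have p0 x : p x = 0 <-> P x by exact: quotmod_proj_of_eq0.
have pup : equationally_pure [set x | p x = 0].
  suff -> : [set x | p x = 0] = P by [].
  by apply/seteqP; split=> x /p0.
have [x /p0/Pf //|f' f'E] := linear_factor (q := f) p_surj.
exists (quotmod (submod_of Psub)), p, f'; split=> // Q Qpure Qf' y Qy.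
have [x xy] := p_surj y; rewrite -xy in Qy *.
apply/p0; apply: (Pmax (p @^-1` Q)) Qy; first exact: pure_submod_preimage.
  by move=> z /Qf' f'pz; rewrite /= -f'E.
by move=> z /p0 /= ->; case: Qpure => -[].
Qed.

End PureSubmodules.

Section SmallSubmodules.
Variable R : pzRingType.
Implicit Types F M N Y : lmodType R.

(* Names for the elements of the least submodule that contains a given element
   and a chosen solution of every solvable system with constants in it; the
   solution has index [k] in [PSol A c k]. *)
Inductive pure_term : Type :=
| PGen
| PLin of R & pure_term & pure_term
| PSol m l of 'M[R]_(m, l) & ('I_m -> pure_term) & 'I_l.

Fixpoint pure_eval Y (y : Y) (t : pure_term) : Y :=
  match t with
  | PGen => y
  | PLin r t u => r *: pure_eval y t + pure_eval y u
  | PSol m l A c k =>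
      xget 0 [set x : 'I_l -> Y | A *v x = (fun j => pure_eval y (c j))] k
  end.

Lemma pure_submod_range_pure_eval Y (y : Y) : pure_submod (range (pure_eval y)).
Proof.
split=> [|m l S b Sb]; first split.
- by exists (PLin (-1) PGen PGen); rewrite //= scaleN1r addNr.
- by move=> r _ _ [t _ <-] [u _ <-]; exists (PLin r t u).
have /choice[c cE] j : exists t, pure_eval y t = (S *v b) j.
  by have [t _] := Sb j; exists t.
have Sb_c : [set x | S *v x = (fun j => pure_eval y (c j))] b.
  by apply/funext => j; rewrite cE.
exists (fun k => pure_eval y (PSol S c k)) => [k|].
  by exists (PSol S c k).
by rewrite [LHS](xgetI 0 Sb_c) -Sb_c.
Qed.

Lemma generic_pure_submod : exists2 F,
  projective_module F & forall Y (y : Y),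
  exists2 e : {linear F -> Y}, pure_submod (range e) & range e y.
Proof.
exists (free_module R {classic pure_term}) => [|Y y].
  exact: free_projective.
exists (free_lift (pure_eval y : {classic pure_term} -> Y)).
  rewrite range_free_lift; first exact: pure_submod_range_pure_eval.
  by case: (pure_submod_range_pure_eval y).
by exists (free_basis R (PGen : {classic pure_term})); rewrite ?free_lift_basis.
Qed.

Section SolutionTerms.
Variables F N : lmodType R.

(* [SSol U g a u] names the value at [u] of a chosen linear map [q] from [F]
   with [f \o q = g] whose restriction to [U] is named by [a]. *)
Inductive solution_term : Type :=
| SZero
| SLin of R & solution_term & solution_term
| SSol of set F & (F -> N) & (F -> solution_term) & F.

Fixpoint solution_eval M (f : M -> N) (t : solution_term) : M :=
  match t with
  | SZero => 0
  | SLin r t u => r *: solution_eval f t + solution_eval f u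
  | SSol U g a u =>
      xget 0 [set q : F -> M | [/\ linear q, f \o q =1 g &
        forall v, U v -> q v = solution_eval f (a v)]] u
  end.

Lemma is_submod_range_solution_eval M (f : M -> N) :
  is_submod (range (solution_eval f)).
Proof.
split=> [|r _ _ [t _ <-] [u _ <-]]; first by exists SZero.
by exists (SLin r t u).
Qed.

Lemma solution_eval_closed M (f : M -> N) (q : {linear F -> M}) :
  exists q' : {linear F -> M}, [/\ forall u, range (solution_eval f) (q' u),
    f \o q' =1 f \o q &
    forall u, range (solution_eval f) (q u) -> q' u = q u].
Proof.
pose U := [set u | range (solution_eval f) (q u)].
have /choice[a aE] u : exists t, U u -> solution_eval f t = q u.
  have [[t _ tE]|nUu] := pselect (U u); first by exists t.
  by exists SZero.
pose solves (q' : F -> M) := [/\ linear q', f \o q' =1 f \o q &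
  forall v, U v -> q' v = solution_eval f (a v)].
have q_solves : solves q by split=> // [r u v|v /aE]; rewrite ?linearP.
have [q'_lin fq' q'U] : solves (fun u => solution_eval f (SSol U (f \o q) a u)).
  exact: xgetI q_solves.
exists (linear_of q'_lin); split=> // u Uu.
by rewrite -aE //; exact: q'U.
Qed.

End SolutionTerms.

(* If [x] is not a value of [solution_eval], a small pure submodule of [M]
   modulo these values contains the class of [x]. The map [q] lifting its
   generators is corrected by [q'], which takes values of [solution_eval] only
   and agrees with [q] wherever [q] takes such a value; this makes the range of
   [q - q'] a pure submodule in the kernel of [f] that meets these values
   trivially. *)
Lemma pure_kernel_free_small N : exists T : choiceType,
  forall M (f : {linear M -> N}), pure_kernel_free f ->
  exists e : T -> M, surjective_map e.
Proof.
have [F projF Fgeneric] := generic_pure_submod.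
exists {classic solution_term F N} => M f f_free; exists (solution_eval f).
pose values := range (@solution_eval F N M f).
have values_sub : is_submod values by exact: is_submod_range_solution_eval.
pose p := quotmod_proj (submod_of values_sub).
have p0 x : p x = 0 <-> values x by exact: quotmod_proj_of_eq0.
move=> x; suff [t _] : values x by exists t.
have [e [_ e_pure] [u _ eu]] := Fgeneric _ (p x).
have [q qE] := projF _ _ p (@quotmod_proj_surj _ _ _) e.
have [q' [q'values fq' q'q]] := solution_eval_closed f q.
pose d : {linear F -> M} := q \- q'.
have pd : p \o d = e.
  by apply/funext => v; rewrite -qE -[LHS]/(p (q v - q' v)) linearB
    (proj2 (p0 _) (q'values v)) subr0.
have d_pure : pure_submod (range d).
  apply: (@pure_submod_range_lift _ _ _ _ p); first by rewrite pd.
  move=> v /p0 dv; apply/eqP; rewrite subr_eq0; apply/eqP/esym/q'q.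
  rewrite -(subrK (q' v) (q v)) -[_ - _]scale1r.
  exact: values_sub.2 dv (q'values v).
have d_ker : range d `<=` [set z | f z = 0].
  by move=> _ [v _ <-]; rewrite /= linearB -[f (q v)]fq' subrr.
have du0 : d u = 0 by apply: f_free d_pure d_ker _ _; exists u.
by apply/p0; rewrite -eu -pd -[LHS]/(p (d u)) du0 linear0.
Qed.

End SmallSubmodules.

Theorem flat_precover_exists (R : pzRingType) (N : lmodType R) :
  exists (G : lmodType R) (g : {linear G -> N}), flat_precover g.
Proof.
have [T Tsmall] := pure_kernel_free_small N.
pose V := free_module R T.
pose I : choiceType := {classic {K : submodClosed V &
  {g : {linear quotmod K -> N} | flat (quotmod K)}}}.
pose K (i : I) : lmodType R := quotmod (projT1 i).
pose g (i : I) : {linear K i -> N} := sval (projT2 i).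
exists (dsum K), (linear_of (dsum_lift_linear g)); split.
  by apply: dsum_flat => -[L [g' flL]].
move=> F flF f.
have [M [p [f' [p_surj pup f'E f'_free]]]] := factor_pure_kernel_free f.
have [e e_surj] := Tsmall M f' f'_free.
have [a [b [aK bK]]] := quotmod_ker_iso (free_lift_surj e_surj).
have flat_ker : flat (quotmod (lin_ker (free_lift e))).
  by apply: flat_retract aK _; exact: flat_pure_quotient pup flF.
pose i : I := existT _ (lin_ker (free_lift e))
  (exist _ (f' \o a : {linear _ -> _}) flat_ker).
exists (dsum_incl (K := K) i \o (b \o p) : {linear _ -> _}) => x.
by rewrite -[LHS]/(dsum_lift g _) dsum_lift_incl /= bK -f'E.
Qed.

(** * IF-rings *)

Section IFRings.
Variable R : pzRingType.
Implicit Types E F M N : lmodType R.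

Lemma IF_embeds_in_flat : IF_ring R -> forall M, embeds_in_flat M.
Proof.
move=> ifR M; have [F [flF [i i_inj]]] := embeds_in_char_module M.
by exists (char_module F), i; split=> //; exact/ifR/flat_right_char_injective.
Qed.

Lemma finitely_presented_embeds_IF :
  (forall M, finitely_presented M -> embeds_in_flat M) -> IF_ring R.
Proof.
move=> emb E injE; apply: flat_of_fp_factor => m l S phi.
have [F [i [flF i_inj]]] := emb _ (finitely_presented_cokermod S).
have [h hE] := injE _ _ i i_inj phi.
by exists F, h, i.
Qed.

Lemma IF_char_flat : IF_ring R ->
  forall F : lmodType R^c, flat_right F -> flat (char_module F).
Proof. by move=> ifR F /flat_right_char_injective; exact: ifR. Qed.

Lemma char_flat_IF :
  (forall F : lmodType R^c, flat_right F -> flat (char_module F)) -> IF_ring R.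
Proof.
move=> char_flat E injE.
have [F [flF [i i_inj]]] := embeds_in_char_module E.
have [r rK] := injE _ _ i i_inj idfun.
by apply: (flat_retract (i := i) (r := r)) => //; exact: char_flat.
Qed.

Lemma IF_FP_injective_quotient : IF_ring R ->
  forall E (N : submodClosed E),
    injective_module E -> FP_injective (submod N) -> flat (quotmod N).
Proof.
move=> ifR E N /ifR flE /FP_injective_equationally_pure puN.
apply: flat_pure_quotient (@quotmod_proj_surj R E N) _ flE.
suff -> : [set x | quotmod_proj N x = 0] = [set` N] by [].
by apply/seteqP; split=> x /quotmod_proj_eq0.
Qed.

Lemma injective_quotient_IF :
  (forall E (N : submodClosed E),
    injective_module E -> injective_module (submod N) -> flat (quotmod N)) ->
  IF_ring R.
Proof.
move=> quo_flat E injE; pose N := lin_ker (idfun : {linear E -> E}).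
have [i [j [_ jK]]] : exists (i : {linear quotmod N -> E})
    (j : {linear E -> quotmod N}), cancel i j /\ cancel j i.
  by apply: quotmod_ker_iso => x; exists x.
apply: flat_retract jK _; apply: quo_flat => // A B k _ f.
exists (\0 : {linear B -> submod N}) => a; apply: val_inj.
by case: (f a) => y yN /=; have /submod_ofP/esym := yN.
Qed.

Lemma flat_completing_domain M N :
  flat N -> flat_precover_completing_domain M N.
Proof.
move=> flN f F g [_ lift]; have [s sK] := lift N flN idfun.
by exists (s \o f : {linear _ -> _}) => x; exact: sK.
Qed.

Lemma f_rugged_exists : exists M, f_rugged M.
Proof.
pose matrices : choiceType := {classic {m & {l & 'M[R]_(m, l)}}}.
pose K (T : matrices) : lmodType R := cokermod (projT2 (projT2 T)).
exists (dsum K) => N; split; last exact: flat_completing_domain.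
move=> completes; have [F [g gcov]] := flat_precover_exists N.
apply: flat_of_fp_factor => m l S phi.
pose T : matrices := existT _ m (existT _ l S).
have [h hE] :=
  completes (phi \o dsum_proj (K := K) T : {linear _ -> _}) F g gcov.
exists F, g, (h \o dsum_incl (K := K) T : {linear _ -> _}); split.
  by case: gcov.
move=> x; rewrite -[LHS]/((g \o h) _) hE -[LHS]/(phi (dsum_proj T _)).
by rewrite dsum_inclK.
Qed.

Lemma f_rugged_embeds_IF :
  (exists M, f_rugged M /\ embeds_in_flat M) -> IF_ring R.
Proof.
move=> [M [rugM [F [i [flF i_inj]]]]] E injE; apply/(rugM E) => f G g [_ lift].
have [f' f'E] := injE _ _ i i_inj f; have [h hE] := lift F flF f'.
exists (h \o i : {linear _ -> _}) => x.
by rewrite -[LHS]/((g \o h) (i x)) hE -f'E.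
Qed.

End IFRings.

Theorem corollary4p8 (R : pzRingType) :
  [<->
    IF_ring R;
    forall M : lmodType R, embeds_in_flat M;
    forall M : lmodType R, pure_projective M -> embeds_in_flat M;
    forall M : lmodType R, finitely_presented M -> embeds_in_flat M;
    forall F : lmodType R^c, flat_right F -> flat (char_module F);
    forall (E : lmodType R) (N : submodClosed E),
      injective_module E -> injective_module (submod N) -> flat (quotmod N);
    forall (E : lmodType R) (N : submodClosed E),
      injective_module E -> FP_injective (submod N) -> flat (quotmod N);
    exists M : lmodType R, f_rugged M /\ embeds_in_flat M].
Proof.
tfae.
- exact: IF_embeds_in_flat.
- by move=> emb M _; exact: emb.
- by move=> emb M /finitely_presented_pure_projective; exact: emb.
- by move=> /finitely_presented_embeds_IF; exact: IF_char_flat.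
- move=> /char_flat_IF ifR E N injE /injective_FP_injective.
  exact: IF_FP_injective_quotient.
- by move=> /injective_quotient_IF; exact: IF_FP_injective_quotient.
- move=> quo_flat; have ifR : IF_ring R.
    apply: injective_quotient_IF => E N injE /injective_FP_injective.
    exact: quo_flat.
  have [M rugM] := f_rugged_exists R.
  by exists M; split; last exact: IF_embeds_in_flat.
- exact: f_rugged_embeds_IF.
Qed.
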